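(* Let $1\le r\le d$ and consider in $\mathbb R^d$ the SDE $$dX_t=-X_t\,dt+dW_t,$$ where $(W_t)_{t\ge0}$ is a $d$-dimensional standard Brownian motion. Let $X^{(r)}_t=U_t^\top Y_t$ be its rank-$r$ DLR approximation. Suppose that $X_0$ has law $\mathcal N(0,I_d)$ and $X_0^{(r)}$ has law $\mathcal N(0,A)$, where $A=\mathrm{diag}(\underbrace{1,\dots,1}_{r},0,\dots,0)$. Then, for all $t\ge0$, $$\mathbb W_2^2\big(\mathscr L_{X_t^{(r)}},\mathscr L_{X_t}\big)=e^{-2t}\,\mathbb W_2^2\big(\mathscr L_{X_0},\mathscr L_{X_0^{(r)}}\big)+\frac{1-e^{-2t}}{2}(d-r).$$
   Context: $\mathscr L_\xi$ denotes the law of $\xi$, $\mathbb W_2$ the 2-Wasserstein distance on probability measures on $\mathbb R^d$ with finite second moment, and $\mathcal N(m,\Sigma)$ the Gaussian law with mean $m$ and covariance $\Sigma$. $(\Omega,\mathscr F,(\mathscr F_t)_{t\ge0},\mathbb P)$ is a filtered complete probability space, $W$ is an $(\mathscr F_t)$-Brownian motion, and initial data are $\mathscr F_0$-measurable. For an SDE $dX_t=b(t,X_t)\,dt+\sigma(t,X_t)\,dW_t$ in $\mathbb R^d$ (here $b(t,x)=-x$ and $\sigma(t,x)=I_d$), the rank-$r$ DLR approximation is $X^{(r)}_t=U_t^\top Y_t$, where $(U_t,Y_t)_{t\ge0}$ is a strong DO solution: $U_t\in\mathbb R^{r\times d}$ is deterministic, $Y_t\in L^2(\Omega,\mathbb R^r)$,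 and (1) $U_0$ has orthonormal rows and the components of $Y_0$ are linearly independent in $L^2(\Omega)$; (2) $U$ is absolutely continuous, $U_tU_t^\top=I_r$ and $U_t\frac{\partial U_t^\top}{\partial t}=0$ for almost every $t$; (3) $Y$ has almost surely continuous paths, $Y_t$ is $\mathscr F_t$-measurable for all $t$, and for every $t$ the components of $Y_t$ are linearly independent in $L^2(\Omega)$; (4) $C_{Y_t}\,dU_t=\mathbb E[Y_tb(t,U_t^\top Y_t)^\top](I_d-P_{U_t})\,dt$ and $dY_t=U_tb(t,U_t^\top Y_t)\,dt+U_t\sigma(t,U_t^\top Y_t)\,dW_t$, where $C_{Y_t}=\mathbb E[Y_tY_t^\top]$ and $P_{U_t}=U_t^\top U_t$. *)

(* Defs.v *)
From HB Require Import structures.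
From mathcomp Require Import all_boot all_order all_algebra.
From mathcomp Require Import all_classical all_reals all_analysis.

Set Implicit Arguments.
Unset Strict Implicit.
Unset Printing Implicit Defensive.

Import Order.TTheory GRing.Theory Num.Theory.
Import numFieldNormedType.Exports.

Local Open Scope classical_set_scope.
Local Open Scope ring_scope.

(* Column vectors carry the sigma-algebra generated by their coordinates, which
   is the Borel sigma-algebra of R^n; this mirrors the library's structure on
   n.-tuple R. *)
Section measurable_colvec.
Context {R : realType} (n : nat).

Definition colvec_coord (i : 'I_n) (x : 'cV[R]_n) : R := x i ord0.

Let colvec_set0 : g_sigma_preimage colvec_coord set0.
Proof. exact: sigma_algebra0. Qed.

Let colvec_setC A :
  g_sigma_preimage colvec_coord A -> g_sigma_preimage colvec_coord (~` A).
Proof. exact: sigma_algebraC. Qed.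

Let colvec_bigcup (F : (set 'cV[R]_n)^nat) :
  (forall i, g_sigma_preimage colvec_coord (F i)) ->
  g_sigma_preimage colvec_coord (\bigcup_i (F i)).
Proof. exact: sigma_algebra_bigcup. Qed.

HB.instance Definition _ :=
  @isMeasurable.Build (measure_tuple_display default_measure_display) 'cV[R]_n
    (g_sigma_preimage colvec_coord) colvec_set0 colvec_setC colvec_bigcup.

End measurable_colvec.

Section laws.
Context {R : realType} (n : nat).
Local Notation E := 'cV[R]_n.

Definition sqnorm (x : E) : R := \sum_(i < n) (x i ord0) ^+ 2.

(* Set functions are only compared on measurable sets: the value of a measure
   on the other sets is not meaningful. *)
Definition coupling (mu nu : set E -> \bar R)
    (pi : probability (E * E)%type R) : Prop :=
  (forall A, measurable A -> pi (fst @^-1` A) = mu A) /\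
  (forall A, measurable A -> pi (snd @^-1` A) = nu A).

Definition wasserstein2 (mu nu : set E -> \bar R) : \bar R :=
  (ereal_inf [set (\int[pi]_z (sqnorm (z.1 - z.2))%:E)%E |
              pi in coupling mu nu] `^ 2^-1)%E.

Definition std_gaussian (gamma : probability E R) : Prop :=
  forall B : 'I_n -> set R, (forall i, measurable (B i)) ->
    gamma [set x : E | forall i, B i (x i ord0)] =
    (\prod_(i < n) normal_prob 0 1 (B i))%E.

Definition psd (S : 'M[R]_n) : Prop :=
  S^T = S /\ forall v : E, 0 <= (v^T *m S *m v) ord0 ord0.

(* N(m, Sigma) is the law of m + Sigma^(1/2) Z with Z standard Gaussian;
   Sigma may be singular. *)
Definition is_gaussian (mu : set E -> \bar R) (m : E) (Sigma : 'M[R]_n) : Prop :=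
  exists (gamma : probability E R) (S : 'M[R]_n),
    [/\ std_gaussian gamma, psd S, S *m S = Sigma &
        forall A, measurable A ->
          mu A = pushforward gamma (fun z : E => m + S *m z) A].

End laws.

Section processes.
Context {R : realType} {disp : measure_display} {T : measurableType disp}.
Variable P : probability T R.

(* All processes are indexed by R, and only their values at t >= 0 matter. *)

Record is_filtration (F : R -> set (set T)) : Prop := {
  filtration_sigma : forall t : R, 0 <= t -> sigma_algebra setT (F t) ;
  filtration_sub : forall t : R, 0 <= t -> F t `<=` measurable ;
  filtration_mono : forall s t : R, 0 <= s -> s <= t -> F s `<=` F t
}.

Definition measurable_wrt d' (E : measurableType d') (G : set (set T))
    (X : T -> E) : Prop :=
  forall B, measurable B -> G (X @^-1` B).

Definition independent_of d' (E : measurableType d') (G : set (set T))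
    (X : T -> E) : Prop :=
  forall A B, G A -> measurable B ->
    P (A `&` X @^-1` B) = (P A * P (X @^-1` B))%E.

Definition ae_continuous_paths n (X : R -> T -> 'cV[R]_n) : Prop :=
  {ae P, forall w, {within `[0, +oo[, continuous (fun t => X t w)}}.

Variable F : R -> set (set T).

Record is_brownian m (W : R -> T -> 'cV[R]_m) : Prop := {
  bm_adapted : forall t : R, 0 <= t -> measurable_wrt (F t) (W t) ;
  bm_0 : {ae P, forall w, W 0 w = 0} ;
  bm_continuous : ae_continuous_paths W ;
  bm_indep : forall s t : R, 0 <= s -> s <= t ->
    independent_of (F s) (fun w => W t w - W s w) ;
  bm_gaussian : forall s t : R, 0 <= s -> s <= t ->
    is_gaussian (pushforward P (fun w => W t w - W s w)) 0 (t - s)%:M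
}.

(* The simple process \sum_(i < n) xi_i 1_(]t_i, t_(i+1)]), with
   0 = t_0 <= ... <= t_n = t and xi_i bounded and F_(t_i)-measurable. *)
Record simple_process (t : R) := SimpleProcess {
  sp_size : nat ;
  sp_time : nat -> R ;
  sp_coef : nat -> T -> R ;
  sp_time0 : sp_time 0 = 0 ;
  sp_timet : sp_time sp_size = t ;
  sp_time_mono : forall i, (i < sp_size)%N -> sp_time i <= sp_time i.+1 ;
  sp_coef_adapted : forall i, (i < sp_size)%N ->
    measurable_wrt (F (sp_time i)) (sp_coef i) ;
  sp_coef_bounded : forall i, (i < sp_size)%N ->
    exists M, forall w, `|sp_coef i w| <= M
}.

Definition sp_val t (S : simple_process t) (s : R) (w : T) : R :=
  \sum_(i < sp_size S)
    sp_coef S i w * \1_(`]sp_time S i, sp_time S i.+1]) s.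

Definition sp_integral t (S : simple_process t) (B : R -> T -> R) (w : T) : R :=
  \sum_(i < sp_size S)
    sp_coef S i w * (B (sp_time S i.+1) w - B (sp_time S i) w).

(* I is (a version of) the Ito integral of phi against B over [0, t]: the
   L2(P)-limit of the integrals of simple processes converging to phi in
   L2(ds x P). *)
Definition is_ito_integral1 (B : R -> T -> R) (t : R) (phi : R -> T -> R)
    (I : T -> R) : Prop :=
  [/\ measurable_fun (`[0, t] `*` [set: T]) (fun p : R * T => phi p.1 p.2),
      (forall s : R, 0 <= s <= t -> measurable_wrt (F s) (phi s)),
      measurable_fun setT I &
      exists S : nat -> simple_process t,
        (\int[lebesgue_measure]_(s in `[0%R, t])
           \int[P]_w ((phi s w - sp_val (S n) s w) ^+ 2)%:E)%E
          @[n --> \oo] --> 0%E /\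
        (\int[P]_w ((I w - sp_integral (S n) B w) ^+ 2)%:E)%E
          @[n --> \oo] --> 0%E].

Definition is_ito_integral k m (W : R -> T -> 'cV[R]_m) (t : R)
    (phi : R -> T -> 'M[R]_(k, m)) (I : T -> 'cV[R]_k) : Prop :=
  exists J : 'I_k -> 'I_m -> T -> R,
    (forall i j, is_ito_integral1 (fun s w => W s w j ord0) t
                   (fun s w => phi s w i j) (J i j)) /\
    forall w, I w = \col_i \sum_(j < m) J i j w.

(* Z is a continuous adapted process with dZ = beta dt + phi dW. *)
Record is_ito_process k m (W : R -> T -> 'cV[R]_m) (beta : R -> T -> 'cV[R]_k)
    (phi : R -> T -> 'M[R]_(k, m)) (Z : R -> T -> 'cV[R]_k) : Prop := {
  ip_adapted : forall t : R, 0 <= t -> measurable_wrt (F t) (Z t) ;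
  ip_continuous : ae_continuous_paths Z ;
  ip_drift : forall t : R, 0 <= t -> {ae P, forall w, forall i,
    lebesgue_measure.-integrable `[0, t] (fun s => (beta s w i ord0)%:E)} ;
  ip_eq : forall t : R, 0 <= t -> exists2 I : T -> 'cV[R]_k,
    is_ito_integral W t phi I &
    {ae P, forall w, Z t w = Z 0 w +
      \col_i (\int[lebesgue_measure]_(s in `[0, t]) beta s w i ord0) + I w}
}.

Definition is_strong_solution d m (W : R -> T -> 'cV[R]_m)
    (b : R -> 'cV[R]_d -> 'cV[R]_d) (sigma : R -> 'cV[R]_d -> 'M[R]_(d, m))
    (X : R -> T -> 'cV[R]_d) : Prop :=
  is_ito_process W (fun t w => b t (X t w)) (fun t w => sigma t (X t w)) X.

(* Meaningful for integrable entries only; this holds for Y in L2 and b of linear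
   growth. *)
Definition expectation_mx p q (M : T -> 'M[R]_(p, q)) : 'M[R]_(p, q) :=
  \matrix_(i, j) fine ('E_P[fun w => M w i j])%E.

Definition L2_lin_indep r (Y : T -> 'cV[R]_r) : Prop :=
  forall c : 'rV[R]_r, {ae P, forall w, c *m Y w = 0} -> c = 0.

Definition absolutely_continuous_on (a b : R) (f : R -> R) : Prop :=
  forall e : R, 0 < e -> exists2 delta : R, 0 < delta &
    forall (n : nat) (u v : 'I_n -> R),
      (forall i, a <= u i /\ u i <= v i /\ v i <= b) ->
      trivIset setT (fun i => `]u i, v i[%classic) ->
      \sum_(i < n) (v i - u i) < delta ->
      \sum_(i < n) `|f (v i) - f (u i)| < e.

(* do_derivable follows from do_ac; it is recorded because derive1 takes
   a default value at points of non-differentiability. *)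
Record is_strong_DO_solution r d m (W : R -> T -> 'cV[R]_m)
    (b : R -> 'cV[R]_d -> 'cV[R]_d) (sigma : R -> 'cV[R]_d -> 'M[R]_(d, m))
    (U : R -> 'M[R]_(r, d)) (Y : R -> T -> 'cV[R]_r) : Prop := {
  do_U0 : U 0 *m (U 0)^T = 1%:M ;
  do_Y0 : L2_lin_indep (Y 0) ;
  do_ac : forall a : R, 0 <= a -> forall i j,
    absolutely_continuous_on 0 a (fun t => U t i j) ;
  do_derivable : {ae lebesgue_measure, forall t : R, 0 <= t -> derivable U t 1} ;
  do_orthonormal : {ae lebesgue_measure, forall t : R, 0 <= t ->
    U t *m (U t)^T = 1%:M /\ U t *m (derive1 U t)^T = 0} ;
  do_L2 : forall t : R, 0 <= t -> forall i,
    (fun w => Y t w i ord0) \in Lfun P 2%:E ;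
  do_indep : forall t : R, 0 <= t -> L2_lin_indep (Y t) ;
  do_eq_U : {ae lebesgue_measure, forall t : R, 0 <= t ->
    expectation_mx (fun w => Y t w *m (Y t w)^T) *m derive1 U t =
    expectation_mx (fun w => Y t w *m (b t ((U t)^T *m Y t w))^T)
      *m (1%:M - (U t)^T *m U t)} ;
  do_eq_Y : is_ito_process W
    (fun t w => U t *m b t ((U t)^T *m Y t w))
    (fun t w => U t *m sigma t ((U t)^T *m Y t w)) Y
}.

Definition DLR r d (U : R -> 'M[R]_(r, d)) (Y : R -> T -> 'cV[R]_r)
    (t : R) (w : T) : 'cV[R]_d := (U t)^T *m Y t w.

End processes.

(* Main.v *)
Require Import Defs.
From HB Require Import structures.
From mathcomp Require Import all_boot all_order all_algebra.
From mathcomp Require Import all_classical all_reals all_analysis.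
From mathcomp Require Import measurable_realfun ring lra.

Set Implicit Arguments.
Unset Strict Implicit.
Unset Printing Implicit Defensive.

Import Order.TTheory GRing.Theory Num.Theory.
Import numFieldNormedType.Exports.

Local Open Scope classical_set_scope.
Local Open Scope ring_scope.

(** The drift -x leaves the row space of [U] invariant, so [C_Y U' = 0]; the Gram
    matrix [C_Y] being invertible, [U] has zero derivative almost everywhere and,
    being absolutely continuous, is constant. Since [U_0^T Y_0] has law
    [N(0, A)] with [A] the diagonal projection of rank [r], linear independence of
    the components of [Y_0] forces [U_0^T U_0 = A].
    Both [X^(r)] and [A X] then solve [dV = - V dt + A dW] with initial data of
    the same law, whence [X^(r)_t] and [A X_t] have the same law: the two
    solutions are almost sure limits of exponential Euler sums
    [e^(-t) V_0 + sum_k e^(-(t - t_k)) A (W_(t_(k+1)) - W_(t_k))], whose law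
    depends on the law of [V_0] only. The coupling [(A X_t, X_t)] is optimal, as
    the last [d - r] coordinates of [X^(r)_t] vanish, and its cost is the sum of
    the second moments [(1 + e^(-2t)) / 2] of the last [d - r] coordinates of
    [X_t], computed by passing to the L2 limit in the same sums. *)

(** * Absolutely continuous functions with zero derivative *)

(** The obstacle is that an Ito integral is available only as an L2 limit of integrals of simple
    processes. For a constant integrand it is identified with a multiple of the increment of [W];
    the equation then holds path by path as an integral equation, and the exponential Euler sums
    converge by a deterministic estimate, without Ito's formula. The weights [e^(-(t - t_k))] are
    the integrating factor of the variation of constants formula. Being deterministic, they make
    each sum linear in [V_0] and in the increments, so its law is obtained by adding one independent
    increment at a time. Almost sure convergence determines the limit law but does not carry second
    moments. The L2 error therefore comes from comparing the sums on a grid and on its refinements,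
    followed by Fatou's lemma; Gaussianity of [X_t] itself is never established. The constant
    [(1 - e^(-2t)) / 2] is the integral of [e^(-2(t - s))] over [[0, t]]. A Gaussian law with
    singular covariance is given through an unspecified positive semidefinite square root, which has
    to be shown unique for multiples of projections. *)

(** Compactness of the segment as an induction on intervals: at the supremum [s] of the points
    reachable from [a], the local property links a reachable point just below [s] to a point beyond
    [s]. It serves for derivatives, uniform continuity and boundedness alike. *)
Lemma cousin (R : realType) (a b : R) (Q : R -> R -> Prop) :
  a <= b ->
  (forall x y z, Q x y -> Q y z -> Q x z) ->
  (forall t, a <= t <= b -> exists2 e : R, 0 < e & forall x y,
    t - e < x -> x <= t <= y -> y < t + e -> a <= x -> y <= b -> Q x y) ->
  Q a b.
Proof.
move=> ab Qtr Qloc.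
pose S := [set x | a <= x <= b /\ Q a x].
have Sa : S a.
  split; first by rewrite lexx.
  have [|e e0 H] := Qloc a; first by rewrite lexx.
  by apply: H; rewrite ?lexx// ?ltrDl// ltrBlDr ltrDl.
have hS : has_sup S.
  by split; [exists a | exists b => x [/andP[_ xb] _]].
pose s := sup S.
have sa : a <= s by exact: (ub_le_sup hS.2 Sa).
have sb : s <= b.
  by apply: ge_sup; [exists a | move=> x [/andP[_ xb] _]].
have [|e e0 H] := Qloc s; first by rewrite sa.
have [x Sx sx] := sup_adherent e0 hS.
have xs : x <= s by exact: (ub_le_sup hS.2 Sx).
case: Sx => /andP[ax xb] Qax.
(* This point is reachable, hence at most [s]; since [s + e / 2] exceeds [s], it must be [b]. *)
pose y := Num.min b (s + e / 2).
have sy : s <= y by rewrite /y le_min sb lerDl divr_ge0// ltW.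
have Qay : Q a y.
  apply: (Qtr _ x) => //; apply: H => //; first by rewrite xs.
    by rewrite /y gt_min ltrD2l ltr_pdivrMr// ltr_pMr// ltr1n orbT.
  by rewrite /y ge_min lexx.
have Sy : S y by split=> //; rewrite (le_trans sa sy)/= /y ge_min lexx.
have ys : y <= s by exact: (ub_le_sup hS.2 Sy).
move: ys; rewrite {1}/y ge_min => /orP[bs|]; last first.
  by rewrite gerDl leNgt divr_gt0.
by have <- : y = b by apply/le_anti; rewrite {1}/y ge_min lexx (le_trans bs sy).
Qed.

Lemma is_derive0_le (R : realType) (f : R -> R) (t e : R) :
  0 < e -> is_derive t (1 : R) f 0 ->
  exists2 r : R, 0 < r &
    forall y, `|y - t| < r -> `|f y - f t| <= e * `|y - t|.
Proof.
move=> e0 [df Df].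
have : (h^-1 *: (f (h *: (1 : R) + t) - f t)) @[h --> 0^'] --> (0 : R).
  by rewrite -[X in _ --> X]Df; exact: df.
move=> /cvgrPdist_le /(_ e e0).
rewrite /dnbhs /within /= => -[r /= r0 H].
exists r => // y yt.
have [->|ynt] := eqVneq y t; first by rewrite !subrr normr0 mulr0.
have yt0 : y - t != 0 by rewrite subr_eq0.
have := H (y - t); rewrite /= sub0r normrN => /(_ yt yt0).
rewrite sub0r normrN scaler1 subrK normrZ normfV.
by rewrite ler_pdivrMl ?normr_gt0// mulrC.
Qed.

Section absolutely_continuous_derive0.
Context {R : realType} (f : R -> R) (e : R) (O : set R).
Local Notation mu := (@lebesgue_measure R).

(* The increments of [f] over the tagged pieces of a partition lying in the small
   open set [O] are kept as a family of disjoint intervals; on the others [f] is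
   [e]-Lipschitz. *)
Definition split_increment (x y : R) : Prop :=
  x <= y /\ exists (n : nat) (u v : 'I_n -> R),
    [/\ forall i, x <= u i /\ u i <= v i /\ v i <= y,
        forall i, `]u i, v i[ `<=` O,
        trivIset setT (fun i => `]u i, v i[%classic) &
        `|f y - f x| <= e * (y - x) + \sum_(i < n) `|f (v i) - f (u i)|].

(** The two families are concatenated. They stay disjoint because every interval of the first ends
    at or before [y], where those of the second begin. *)
Lemma split_increment_trans x y z :
  split_increment x y -> split_increment y z -> split_increment x z.
Proof.
move=> [xy [n1 [u1 [v1 [b1 O1 T1 i1]]]]] [yz [n2 [u2 [v2 [b2 O2 T2 i2]]]]].
split; first exact: le_trans xy yz.
exists (n1 + n2)%N.
exists (fun i => match fintype.split i with inl j => u1 j | inr j => u2 j end).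
exists (fun i => match fintype.split i with inl j => v1 j | inr j => v2 j end).
split.
- move=> i; case: (fintype.split i) => j.
    by have [? [? ?]] := b1 j; split=> //; split=> //; exact: le_trans yz.
  by have [? [? ?]] := b2 j; split; [exact: le_trans xy _|].
- by move=> i; case: (fintype.split i) => j.
- apply/trivIsetP => i j _ _ /eqP ij.
  apply/seteqP; split=> // w [] /=.
  have {ij} : fintype.split i <> fintype.split j.
    by move=> H; apply: ij; rewrite -[i]splitK -[j]splitK H.
  case: (fintype.split i) => i'; case: (fintype.split j) => j' ij; rewrite !in_itv/=.
  + move=> wi wj; apply: ij; congr inl; apply: (T1 i' j') => //.
    by exists w; split; rewrite /= in_itv.
  + move=> /andP[_ h1] /andP[h2 _].
    have [_ [_ h3]] := b1 i'; have [h4 _] := b2 j'.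
    by have := lt_trans h2 h1; rewrite ltNge (le_trans h3 h4).
  + move=> /andP[h1 _] /andP[_ h2].
    have [_ [_ h3]] := b1 j'; have [h4 _] := b2 i'.
    by have := lt_trans h1 h2; rewrite ltNge (le_trans h3 h4).
  + move=> wi wj; apply: ij; congr inr; apply: (T2 i' j') => //.
    by exists w; split; rewrite /= in_itv.
- rewrite big_split_ord/=.
  under eq_bigr do rewrite (unsplitK (inl _)).
  under [X in _ + (_ + X)]eq_bigr do rewrite (unsplitK (inr _)).
  have -> : f z - f x = (f y - f x) + (f z - f y) by ring.
  apply: (le_trans (ler_normD _ _)).
  by apply: (le_trans (lerD i1 i2)); lra.
Qed.

Lemma lebesgue_trivIset_itvoo n (u v : 'I_n -> R) :
  (forall i, u i <= v i) -> measurable O ->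
  (forall i, `]u i, v i[ `<=` O) ->
  trivIset setT (fun i => `]u i, v i[%classic) ->
  ((\sum_(i < n) (v i - u i))%:E <= mu O)%E.
Proof.
move=> uv mO uvO tuv.
have -> : ((\sum_(i < n) (v i - u i))%:E =
    mu (\big[setU/set0]_(i < n) `]u i, v i[%classic))%E.
  rewrite -sumEFin measure_bigsetU_ord//=.
  apply: eq_bigr => i _; rewrite lebesgue_measure_itv/= lte_fin.
  case: ltP => [_|vu]; first by rewrite EFinB.
  by have -> : v i = u i by [apply/le_anti; rewrite vu uv]; rewrite subrr.
apply: le_measure; rewrite ?inE//.
- by apply: bigsetU_measurable => i _; exact: measurable_itv.
- apply: (@big_ind _ (fun X => X `<=` O)) ; [by []| |by move=> i _; exact: uvO].
  by move=> A B AO BO; rewrite subUset.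
Qed.

End absolutely_continuous_derive0.

(** The exceptional null set is enclosed in an open set [O] of measure below the [delta] of absolute
    continuity. In a partition given by [cousin], pieces tagged by exceptional points lie in [O] and
    contribute less than [e] in total; the others contribute at most [e * (b - a)]. *)
Lemma absolutely_continuous_derive0 (R : realType) (f : R -> R) (a b : R) :
  a <= b -> absolutely_continuous_on a b f ->
  {ae (@lebesgue_measure R), forall t, a <= t <= b -> is_derive t (1 : R) f 0} ->
  f b = f a.
Proof.
move=> ab fac [N0 [mN0 N00 N0sub]].
apply/eqP; rewrite -subr_eq0 -normr_le0; apply/ler_addgt0Pl => e0 e00.
rewrite addr0.
(* Chosen so that [e * (b - a) + e = e0]. *)
pose e := e0 / (b - a + 1).
have ba : 0 < b - a + 1 by lra.
have e0' : 0 < e by rewrite divr_gt0.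
have [dl dl0 H] := fac e e0'.
have [|O [oO N0O mO]] := @lebesgue_regularity_outer R N0 dl mN0 _ dl0.
  by rewrite [X in (X < _)%E](_ : _ = 0%E) ?ltry//; exact: N00.
(* Outer regularity bounds only the part of [O] outside [N0]; as [N0] is null, the bound extends to
   [O]. *)
have mO' : (lebesgue_measure O < dl%:E)%E.
  apply: le_lt_trans mO; rewrite -[X in (_ <= X)%E]adde0 -N00.
  have mOm := open_measurable oO.
  rewrite -measureU//; [|exact: measurableD|by rewrite setIC setDIK].
  apply: le_measure; rewrite ?inE//.
    by apply: measurableU => //; exact: measurableD.
  by rewrite setUC setDUK.
have hsi : split_increment f e O a b.
  apply: (cousin ab).
  - exact: split_increment_trans.
  - move=> t /andP[at_ tb].
    have [Nt|Nt] := pselect (N0 t).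
      have /nbhs_ballP [r /= r0 tr] := open_nbhs_nbhs (conj oO (N0O _ Nt)).
    exists r => // x y xr /andP[xt ty] yr ax yb; split; first exact: le_trans ty.
      exists 1%N; exists (fun=> x); exists (fun=> y); split.
      + by move=> _; split=> //; split=> //; exact: le_trans ty.
      + move=> _ z /=; rewrite in_itv/= => /andP[xz zy]; apply: tr.
        by rewrite /ball/= ltr_distlC; apply/andP; split; lra.
      + by apply/trivIsetP => i j _ _; rewrite !ord1 eqxx.
      + rewrite big_ord1 lerDr mulr_ge0 ?subr_ge0//; first exact: ltW.
        exact: le_trans ty.
    have [r r0 Hr] : exists2 r : R, 0 < r &
        forall y, `|y - t| < r -> `|f y - f t| <= e * `|y - t|.
      apply: is_derive0_le => //; apply: contrapT => nd; apply: Nt.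
      by apply: N0sub => /= H'; apply: nd; apply: H'; rewrite at_ tb.
    exists r => // x y xr /andP[xt ty] yr ax yb; split; first exact: le_trans ty.
    exists 0%N; exists (fun=> x); exists (fun=> x); split; [by case|by case| |].
      by apply/trivIsetP; case.
    rewrite big_ord0 addr0.
    have hx : `|f x - f t| <= e * (t - x).
      rewrite -[t - x]ger0_norm ?subr_ge0// distrC (distrC t) (distrC (f t)).
      by apply: Hr; rewrite distrC ger0_norm ?subr_ge0//; lra.
    have hy : `|f y - f t| <= e * (y - t).
      rewrite -[y - t]ger0_norm ?subr_ge0//.
      by apply: Hr; rewrite ger0_norm ?subr_ge0//; lra.
    have -> : f y - f x = (f y - f t) - (f x - f t) by ring.
    apply: (le_trans (ler_normB _ _)).
    by apply: (le_trans (lerD hy hx)); lra.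
have [_ [n [u [v [h1 h2 h3 h4]]]]] := hsi.
have : \sum_(i < n) `|f (v i) - f (u i)| < e.
    apply: H => //.
    rewrite -lte_fin; apply: le_lt_trans mO'.
    apply: lebesgue_trivIset_itvoo => //; last exact: open_measurable.
    by move=> i; have [? []] := h1 i.
  move=> hs; apply: (le_trans h4).
  have -> : e0 = e * (b - a) + e by rewrite /e; field; rewrite gt_eqF.
  by rewrite lerD2l ltW.
Qed.

(** * Square roots of idempotents and orthogonal projections *)

Section matrix_facts.
Context {R : realType}.

(** The trace is the sum of the squares of the entries of [M]. *)
Lemma mxtrace_trmx_mul_eq0 m n (M : 'M[R]_(m, n)) :
  \tr (M^T *m M) = 0 -> M = 0.
Proof.
move=> h; apply/matrixP => i j; rewrite mxE; apply/eqP; rewrite -sqrf_eq0.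
move: h; rewrite /mxtrace => /eqP.
rewrite psumr_eq0; last first.
  move=> k _; rewrite mxE; apply: sumr_ge0 => l _.
  by rewrite mxE -expr2 sqr_ge0.
move=> /allP /(_ j); rewrite mem_index_enum => /(_ isT) /=.
rewrite mxE psumr_eq0; last by move=> l _; rewrite mxE -expr2 sqr_ge0.
by move=> /allP /(_ i); rewrite mem_index_enum => /(_ isT) /=; rewrite mxE -expr2.
Qed.

Lemma mulmx_trmx_eq0 m n (M : 'M[R]_(m, n)) : M^T *m M = 0 -> M = 0.
Proof. by move=> h; apply: mxtrace_trmx_mul_eq0; rewrite h mxtrace0. Qed.

(** A row [v] in the kernel satisfies [v S = - c v], so [v S v^T = - c |v|^2], which positivity of
    [S] forbids unless [v = 0]. *)
Lemma psd_scalar_unitmx n (S : 'M[R]_n) (c : R) :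
  psd S -> 0 < c -> S + c%:M \in unitmx.
Proof.
move=> [ST Sp] c0; rewrite -unitmx_tr -row_free_unit -kermx_eq0.
apply/eqP/row_matrixP => i; rewrite row0.
set v := row i _.
have hv : v *m (S + c%:M)^T = 0 by rewrite /v -row_mul mulmx_ker row0.
have := Sp v^T; rewrite trmxK.
have hS : v *m S = - c *: v.
  have := hv; rewrite linearD/= ST tr_scalar_mx mulmxDr mul_mx_scalar => /eqP.
  by rewrite addr_eq0 scaleNr => /eqP.
rewrite hS -scalemxAl mxE mulNr oppr_ge0 pmulr_rle0// => h.
have h' : v *m v^T = 0.
  apply/matrixP => a b; rewrite !ord1 [RHS]mxE; apply/le_anti; rewrite h/=.
  by rewrite mxE; apply: sumr_ge0 => k _; rewrite [v^T _ _]mxE -expr2 sqr_ge0.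
have : (v^T)^T *m v^T = 0 by rewrite trmxK.
by move/mulmx_trmx_eq0 => h2; rewrite -[v]trmxK h2 trmx0.
Qed.

(** Identifies the square root left unspecified in [is_gaussian]. From [S S = c^2 A] one gets
    [S (1 - A) = 0], hence [S A = A S = S] and [(S - c A) (S + c) = 0]; for [c > 0] the second
    factor is invertible. *)
Lemma psd_sqrt_idempotent n (S A : 'M[R]_n) (c : R) :
  psd S -> 0 <= c -> A *m A = A -> A^T = A ->
  S *m S = (c ^+ 2) *: A -> S = c *: A.
Proof.
move=> pS c0 AA AT SS.
have ST : S^T = S by case: pS.
have SA : S *m (1%:M - A) = 0.
  apply: mulmx_trmx_eq0; rewrite trmx_mul ST -mulmxA (mulmxA S S) SS.
  by rewrite -scalemxAl mulmxBr mulmx1 AA subrr scaler0 mulmx0.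
have {SA}SA : S *m A = S.
  by apply/esym/eqP; rewrite -subr_eq0 -{1}[S]mulmx1 -mulmxBr SA.
have AS : A *m S = S by rewrite -[in RHS]ST -[in RHS]SA trmx_mul ST AT.
move: c0; rewrite le_eqVlt => /predU1P[c0|c0].
  rewrite -c0 scale0r; apply: mulmx_trmx_eq0.
  by rewrite ST SS -c0 expr0n scale0r.
apply/eqP; rewrite -subr_eq0; apply/eqP.
rewrite -[LHS](mulmxK (psd_scalar_unitmx pS c0)).
rewrite (_ : _ *m (S + _) = 0) ?mul0mx//.
rewrite mulmxBl !mulmxDr !mul_mx_scalar SS -!scalemxAl AS.
by rewrite scalerA -expr2 [X in X - _]addrC subrr.
Qed.

(** Both [Q = U^T U] and [A = pid_mx r] are orthogonal projections of trace [r], and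
    [Q A = A Q = Q]. Hence [(A - Q)^T (A - Q) = A - Q] has trace zero. *)
Lemma orthonormal_rows_proj r d (U : 'M[R]_(r, d)) : (r <= d)%N ->
  U *m U^T = 1%:M -> (forall (i : 'I_r) (j : 'I_d), (r <= j)%N -> U i j = 0) ->
  U^T *m U = pid_mx r.
Proof.
move=> rd UU U0.
set A : 'M[R]_d := pid_mx r; set Q := U^T *m U.
have AT : A^T = A by rewrite /A tr_pid_mx.
have AA : A *m A = A by rewrite /A mul_pid_mx !minnn (minn_idPr rd).
have QT : Q^T = Q by rewrite /Q trmx_mul trmxK.
have QQ : Q *m Q = Q by rewrite /Q mulmxA -(mulmxA U^T) UU mulmx1.
have UA : U *m A = U.
  apply/matrixP => i j; rewrite mxE (bigD1 j)//= big1 ?addr0; last first.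
    by move=> k kj; rewrite mxE (negbTE (_ : (k != j :> nat))) ?mulr0.
  rewrite mxE eqxx/=; case: ltnP => [_|rj]; first by rewrite mulr1.
  by rewrite U0// mul0r.
have QA : Q *m A = Q by rewrite /Q -mulmxA UA.
have AQ : A *m Q = Q by rewrite -[in RHS]QT -[in RHS]QA trmx_mul QT AT.
apply/esym/eqP; rewrite -subr_eq0; apply/eqP/mxtrace_trmx_mul_eq0.
rewrite [(_ - _)^T]linearB/= AT QT mulmxBl !mulmxBr AA QQ AQ QA subrr subr0.
rewrite linearB/= /Q mxtrace_mulC UU mxtrace1.
rewrite /mxtrace (eq_bigr (fun i : 'I_d => (nat_of_bool (i < r)%N)%:R)); last first.
  by move=> i _; rewrite mxE eqxx.
rewrite -natr_sum -big_mkcond/= -(big_ord_widen d (fun=> 1%N) rd).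
by rewrite sum1_card card_ord subrr.
Qed.

End matrix_facts.

(** * Measurability, laws and independence *)

Section colvec_measurability.
Context {R : realType}.

Lemma measurable_colvec_coord n (i : 'I_n) :
  measurable_fun setT (fun x : 'cV[R]_n => x i ord0).
Proof.
move=> _ B mB; rewrite setTI; apply: sub_sigma_algebra => /=.
rewrite -bigcup_seq/=; exists i => /=; first by rewrite mem_index_enum.
by exists B => //; rewrite setTI.
Qed.

Lemma measurable_fun_colvecP d (T : measurableType d) n (f : T -> 'cV[R]_n) :
  measurable_fun setT f <-> forall i, measurable_fun setT (fun w => f w i ord0).
Proof.
split=> [mf i|mf _ B mB].
  exact: (measurableT_comp (measurable_colvec_coord i) mf).
rewrite setTI; move: B mB.
pose C := [set B : set 'cV[R]_n | measurable (f @^-1` B)].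
have sC : sigma_algebra setT C.
  split => /=.
  - by rewrite /C/= preimage_set0.
  - by move=> A CA; rewrite /C/= setTD preimage_setC; exact: measurableC.
  - by move=> A CA; rewrite /C/= preimage_bigcup; exact: bigcupT_measurable.
apply: smallest_sub => //.
rewrite -bigcup_seq => A [/= i _ [B mB <-]]; rewrite /C/= setTI.
by rewrite -[X in measurable X]setTI; exact: mf.
Qed.

Lemma measurable_colvecD d (T : measurableType d) n (f g : T -> 'cV[R]_n) :
  measurable_fun setT f -> measurable_fun setT g ->
  measurable_fun setT (fun w => f w + g w).
Proof.
move=> /measurable_fun_colvecP mf /measurable_fun_colvecP mg.
apply/measurable_fun_colvecP => i.
rewrite (_ : (fun _ => _) = (fun w => f w i ord0) \+ (fun w => g w i ord0)).
  exact: measurable_funD.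
by apply/funext => w /=; rewrite mxE.
Qed.

Lemma measurable_colvec_mulmx d (T : measurableType d) m n (M : 'M[R]_(m, n))
    (f : T -> 'cV[R]_n) :
  measurable_fun setT f -> measurable_fun setT (fun w => M *m f w).
Proof.
move=> /measurable_fun_colvecP mf.
apply/measurable_fun_colvecP => i.
rewrite (_ : (fun _ => _) = (fun w => \sum_j M i j * f w j ord0)).
  by apply: measurable_sum => j; exact: measurable_funM.
by apply/funext => w /=; rewrite mxE.
Qed.

Lemma measurable_colvecZ d (T : measurableType d) n (c : R)
    (f : T -> 'cV[R]_n) :
  measurable_fun setT f -> measurable_fun setT (fun w => c *: f w).
Proof.
move=> mf; rewrite (_ : (fun _ => _) = (fun w => c%:M *m f w)).
  exact: measurable_colvec_mulmx.
by apply/funext => w; rewrite mul_scalar_mx.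
Qed.

End colvec_measurability.

Section sub_sigma_algebras.
Context d (T : measurableType d).
Context (G : set (set T)) (sG : sigma_algebra setT G).

(** Makes the closure properties of [measurable_fun] available for adaptedness: [G] coincides with
    the sigma-algebra that it generates. *)
Lemma measurable_wrtP d' (E : measurableType d') (X : T -> E) :
  measurable_wrt G X <->
  measurable_fun setT (X : g_sigma_algebraType G -> E).
Proof.
have GE : @measurable _ (g_sigma_algebraType G) = G by exact: sigma_algebra_id.
split=> [mX _ B mB|mX B mB]; first by rewrite GE setTI; exact: mX.
by rewrite -GE -[X in measurable X]setTI; exact: mX.
Qed.

End sub_sigma_algebras.

Lemma measurable_wrt_sub d (T : measurableType d) (G H : set (set T)) d'
    (E : measurableType d') (X : T -> E) :
  G `<=` H -> measurable_wrt G X -> measurable_wrt H X.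
Proof. by move=> GH mX B mB; apply: GH; exact: mX. Qed.

Lemma measurable_wrt_measurable d (T : measurableType d) (G : set (set T)) d'
    (E : measurableType d') (X : T -> E) :
  G `<=` measurable -> measurable_wrt G X -> measurable_fun setT X.
Proof. by move=> GH mX _ B mB; rewrite setTI; apply: GH; exact: mX. Qed.

Definition mfun_of d d' (T : measurableType d) (E : measurableType d')
    (X : T -> E) (mX : measurable_fun setT X) : {mfun T >-> E} :=
  HB.pack X (isMeasurableFun.Build _ _ _ _ _ mX).

Definition law d d' (T : measurableType d) (E : measurableType d')
    (R : realType) (P : probability T R) (X : T -> E)
    (mX : measurable_fun setT X) : probability E R :=
  distribution P (mfun_of mX).

Definition same_law d d' (T : measurableType d) (E : measurableType d')
    (R : realType) (P : probability T R) (X Y : T -> E) : Prop :=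
  forall B, measurable B -> P (X @^-1` B) = P (Y @^-1` B).

Section independence.
Context d (T : measurableType d) (R : realType) (P : probability T R)
  (G : set (set T)) (Gm : G `<=` measurable).
Context d1 d2 (E1 : measurableType d1) (E2 : measurableType d2).
Implicit Types (X : T -> E1) (D : T -> E2).

(** Independence is the equality of the two measures on rectangles, and rectangles determine a
    product measure. *)
Lemma independent_product_law X D (mX : measurable_fun setT X)
    (mD : measurable_fun setT D) :
  measurable_wrt G X -> independent_of P G D ->
  forall C, measurable C ->
  (law P mX \x law P mD)%E C = P ((fun w => (X w, D w)) @^-1` C).
Proof.
move=> GX iD C mC.
have mXD : measurable_fun setT (fun w => (X w, D w)).
  exact: measurable_fun_pair.
apply: (@product_measure_unique _ _ _ _ R (law P mX) (law P mD) (law P mXD)) => //.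
by move=> A B mA mB; exact: iD (GX _ mA) mB.
Qed.

(** The joint law of [(X, D)] is a product, so it depends on [X] through its law alone. This is the
    inductive step when one more Brownian increment is added. *)
Lemma same_law_pair X X' D d3 (E3 : measurableType d3) (phi : E1 * E2 -> E3) :
  measurable_fun setT phi -> measurable_fun setT D ->
  measurable_wrt G X -> measurable_wrt G X' -> independent_of P G D ->
  same_law P X X' ->
  same_law P (fun w => phi (X w, D w)) (fun w => phi (X' w, D w)).
Proof.
move=> mphi mD GX GX' iD XX' B mB.
have mX := measurable_wrt_measurable Gm GX.
have mX' := measurable_wrt_measurable Gm GX'.
have mphiB : measurable (phi @^-1` B).
  by rewrite -[X in measurable X]setTI; exact: mphi.
have := independent_product_law mX mD GX iD mphiB.
have := independent_product_law mX' mD GX' iD mphiB.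
rewrite /preimage/= => <- <-.
apply: (@product_measure_unique _ _ _ _ R (law P mX) (law P mD)
  (law P mX' \x law P mD)%E) => //.
move=> A C mA mC; rewrite /= product_measure1E//=.
by congr (_ * _)%E; apply/esym; exact: XX'.
Qed.

Lemma independent_tonelli X D (f : E1 * E2 -> R) :
  measurable_fun setT f -> (forall z, 0 <= f z) ->
  measurable_fun setT X -> measurable_fun setT D ->
  measurable_wrt G X -> independent_of P G D ->
  (\int[P]_w (f (X w, D w))%:E =
   \int[P]_w \int[P]_w' (f (X w, D w'))%:E)%E.
Proof.
move=> mf f0 mX mD GX iD.
have mXD : measurable_fun setT (fun w => (X w, D w)).
  exact: measurable_fun_pair.
have mEf : measurable_fun setT (EFin \o f) by exact/measurable_EFinP.
transitivity (\int[law P mXD]_z (f z)%:E)%E.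
  by rewrite (ge0_integral_distribution (mfun_of mXD)).
rewrite (@eq_measure_integral _ _ _ _ (law P mX \x law P mD)%E); last first.
  by move=> A mA _; exact/esym/(independent_product_law mX mD GX iD mA).
rewrite fubini_tonelli1//.
rewrite (ge0_integral_distribution (mfun_of mX))//=; last 2 first.
- by apply: measurable_fun_fubini_tonelli_F => // z; rewrite lee_fin.
- by move=> y; apply: integral_ge0 => z _; rewrite lee_fin.
apply: eq_integral => w _ /=.
rewrite /fubini_F (ge0_integral_distribution (mfun_of mD))//.
- by apply/measurable_EFinP; apply: measurableT_comp.
- by move=> z; rewrite lee_fin.
Qed.

End independence.

Lemma cvg_maxr (R : realType) (T : Type) (F : set_system T) (FF : Filter F)
    (f g : T -> R) (a b : R) :
  f x @[x --> F] --> a -> g x @[x --> F] --> b ->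
  Num.max (f x) (g x) @[x --> F] --> Num.max a b.
Proof.
move=> fa gb; under eq_fun do rewrite maxr_absE; rewrite maxr_absE.
apply: cvgM; last exact: cvg_cst.
by apply: cvgD; [exact: cvgD|apply: cvg_norm; exact: cvgB].
Qed.

Section laws_on_colvec.
Context {R : realType} (n : nat).
Local Notation E := 'cV[R]_n.

(** Used with two classes [C]: rectangles, which characterize the standard Gaussian law, and
    sublevel sets of continuous functions, which suit almost sure limits. *)
Lemma colvec_measure_ext (C : set (set E)) (mu nu : {measure set E -> \bar R}) :
  setI_closed C -> C `<=` measurable -> C setT -> (mu setT < +oo)%E ->
  (forall i (B : set R), measurable B ->
    <<s C >> [set x : E | B (x i ord0)]) ->
  (forall A, C A -> mu A = nu A) ->
  forall A, measurable A -> mu A = nu A.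
Proof.
move=> CI Cm CT muT Ccoord munu A mA.
apply: (measure_unique C (fun=> setT)) => //.
  apply/seteqP; split; last first.
    by apply: smallest_sub => //; exact: sigma_algebra_measurable.
  apply: smallest_sub; first exact: smallest_sigma_algebra.
  rewrite -bigcup_seq => B [/= i _ [D mD <-]]; rewrite setTI.
  exact: Ccoord.
by apply/seteqP; split=> // x _; exists 0%N.
Qed.

Lemma colvec_rectangle_ext (mu nu : probability E R) :
  (forall B : 'I_n -> set R, (forall i, measurable (B i)) ->
    mu [set x : E | forall i, B i (x i ord0)] =
    nu [set x : E | forall i, B i (x i ord0)]) ->
  forall A, measurable A -> mu A = nu A.
Proof.
move=> H; have muT : (mu setT < +oo)%E by rewrite probability_setT ltry.
apply: (colvec_measure_ext (C := [set A | exists2 B : 'I_n -> set R,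
  (forall i, measurable (B i)) & A = [set x : E | forall i, B i (x i ord0)]])).
- move=> _ _ [B mB ->] [D mD ->]; exists (fun i => B i `&` D i).
    by move=> i; exact: measurableI.
  apply/seteqP; split=> [x [Bx Dx] i //|x BD].
  by split=> i; have [] := BD i.
- move=> _ [B mB ->].
  rewrite (_ : [set _ | _] =
    \big[setI/setT]_(i < n) [set x : E | B i (x i ord0)]); last first.
    rewrite -bigcap_seq; apply/seteqP; split=> [x /= Bx i _|x Bx i]; first exact: Bx.
    by apply: Bx; rewrite /= mem_index_enum.
  apply: bigsetI_measurable => i _.
  by rewrite -[X in measurable X]setTI; exact: measurable_colvec_coord.
- by exists (fun=> setT) => //; apply/seteqP; split.
- exact: muT.
- move=> i B mB; apply: sub_sigma_algebra.
  exists (fun j => if j == i then B else setT); first by move=> j; case: ifP.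
  apply/seteqP; split=> [x /= Bx j|x /= /(_ i)]; last by rewrite eqxx.
  by case: eqP => // ->.
- by move=> _ [B mB ->]; exact: H.
Qed.

Definition coord_cvg (x : nat -> E) (y : E) : Prop :=
  forall i, x k i ord0 @[k --> \oo] --> y i ord0.

(** Continuity along coordinatewise convergent sequences is all that an almost sure limit requires,
    and it is stable under maxima. *)
Definition seq_continuous (g : E -> R) : Prop :=
  forall x y, coord_cvg x y -> g (x k) @[k --> \oo] --> g y.

(** Sublevel sets are stable under intersection, by taking the maximum of the two functions, and
    they contain the half-spaces [a <= x_i], which generate the sigma-algebra. *)
Lemma colvec_closed_ext (mu nu : {measure set E -> \bar R}) :
  (mu setT < +oo)%E ->
  (forall g : E -> R, measurable_fun setT g -> seq_continuous g ->
    mu [set x | g x <= 0] = nu [set x | g x <= 0]) ->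
  forall A, measurable A -> mu A = nu A.
Proof.
move=> muT H; apply: (colvec_measure_ext (C := [set A | exists2 g : E -> R,
  measurable_fun setT g /\ seq_continuous g & A = [set x | g x <= 0]])) => //.
- move=> _ _ [g [mg cg] ->] [h [mh ch] ->]; exists (g \max h).
    split; first exact: measurable_maxr.
    by move=> x y xy; apply: cvg_maxr; [exact: cg|exact: ch].
  by apply/seteqP; split=> x /=; rewrite ge_max => /andP.
- move=> _ [g [mg _] ->]; rewrite -[X in measurable X]setTI.
  rewrite (_ : [set x | _] = g @^-1` `]-oo, 0]); first exact: mg.
  by apply/seteqP; split=> x /=; rewrite in_itv.
- exists (cst 0); last by apply/seteqP; split => x //= _; rewrite lexx.
  by split=> // x y _; exact: cvg_cst.
- move=> i B mB.
  have := @measurability _ _ (g_sigma_algebraType [set A | exists2 g : E -> R,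
    measurable_fun setT g /\ seq_continuous g & A = [set x | g x <= 0]])
    (measurableTypeR R) setT (fun x : E => x i ord0) _ (@RGenCInfty.measurableE R).
  move=> H'; have := H' _ measurableT _ mB; rewrite setTI; apply.
  move=> _ [_ [a ->] <-]; apply: sub_sigma_algebra.
  exists (fun x : E => a - x i ord0).
    split.
      by apply: measurable_funB => //; exact: measurable_colvec_coord.
    by move=> x y xy; apply: cvgB; [exact: cvg_cst|exact: xy].
  by rewrite setTI; apply/seteqP; split=> x /=; rewrite in_itv/= andbT subr_le0.
- by move=> _ [g [mg cg] ->]; exact: H.
Qed.

Context d (T : measurableType d) (P : probability T R).

Lemma same_law_integral d' (E' : measurableType d') (X Y : T -> E')
    (f : E' -> R) :
  measurable_fun setT X -> measurable_fun setT Y -> same_law P X Y ->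
  measurable_fun setT f -> (forall x, 0 <= f x) ->
  (\int[P]_w (f (X w))%:E = \int[P]_w (f (Y w))%:E)%E.
Proof.
move=> mX mY XY mf f0.
have mEf : measurable_fun setT (EFin \o f) by exact/measurable_EFinP.
have f0' y : (0 <= (EFin \o f) y)%E by rewrite /= lee_fin.
rewrite -(ge0_integral_distribution (mfun_of mX) mEf f0').
rewrite -(ge0_integral_distribution (mfun_of mY) mEf f0').
by apply: eq_measure_integral => A mA _; exact: XY.
Qed.

Lemma cvg_bounded_expectation (f_ : nat -> T -> R) (f : T -> R) :
  (forall k, measurable_fun setT (f_ k)) -> measurable_fun setT f ->
  (forall k w, 0 <= f_ k w <= 1) ->
  {ae P, forall w, f_ k w @[k --> \oo] --> f w} ->
  (\int[P]_w (f_ k w)%:E)%E @[k --> \oo] --> (\int[P]_w (f w)%:E)%E.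
Proof.
move=> mf_ mf f01 f_f.
have [//|||||_ _] := @dominated_convergence _ T R P setT measurableT
  (fun k w => (f_ k w)%:E) (fun w => (f w)%:E) (cst 1%E).
- by move=> k; exact/measurable_EFinP.
- exact/measurable_EFinP.
- apply: filterS f_f => w f_fw _.
  by apply: cvg_EFin => //; exact: nearW.
- exact: finite_measure_integrable_cst.
- apply: aeW => w k _ /=; rewrite lee_fin ger0_norm; by have /andP[] := f01 k w.
- exact.
Qed.

(** With [psi u = e^(- max(u, 0))], the powers [psi (g x) ^+ k] are continuous, lie in [[0, 1]] and
    tend to the indicator of [g <= 0]. Expectations pass to the limit along the sequence for fixed
    [k], then as [k] grows. *)
Lemma same_law_limit (X_ Y_ : nat -> T -> E) (X Y : T -> E) :
  (forall k, measurable_fun setT (X_ k)) ->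
  (forall k, measurable_fun setT (Y_ k)) ->
  measurable_fun setT X -> measurable_fun setT Y ->
  {ae P, forall w, coord_cvg (X_ ^~ w) (X w)} ->
  {ae P, forall w, coord_cvg (Y_ ^~ w) (Y w)} ->
  (forall k, same_law P (X_ k) (Y_ k)) -> same_law P X Y.
Proof.
move=> mX_ mY_ mX mY cX cY XY_.
suff : forall B, measurable B -> law P mX B = law P mY B by [].
have muT : (law P mX setT < +oo)%E by rewrite probability_setT ltry.
apply: (colvec_closed_ext muT).
move=> g mg cg.
pose psi (u : R) := expR (- Num.max u 0).
have mpsi : measurable_fun setT psi.
  apply: measurableT_comp => //; apply: measurableT_comp => //.
  exact: measurable_maxr.
have psi01 u : 0 <= psi u <= 1.
  by rewrite expR_ge0/= -expR0 ler_expR oppr_le0 le_max lexx orbT.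
have psik01 k u : 0 <= psi u ^+ k <= 1.
  by have /andP[p0 p1] := psi01 u; rewrite exprn_ge0//= exprn_ile1.
have cpsi : continuous psi.
  move=> u; apply: (cvg_comp _ expR); last exact: continuous_expR.
  by apply: cvgN; apply: cvg_maxr; [exact: cvg_id|exact: cvg_cst].
have mcomp k (Z : T -> E) : measurable_fun setT Z ->
    measurable_fun setT (fun w => psi (g (Z w)) ^+ k).
  move=> mZ; apply: measurable_funX; apply: (measurableT_comp mpsi).
  exact: (measurableT_comp mg).
have lim_psi k : (\int[P]_w (psi (g (X w)) ^+ k)%:E =
                  \int[P]_w (psi (g (Y w)) ^+ k)%:E)%E.
  have h (Z_ : nat -> T -> E) Z : (forall j, measurable_fun setT (Z_ j)) ->
      measurable_fun setT Z -> {ae P, forall w, coord_cvg (Z_ ^~ w) (Z w)} ->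
      (\int[P]_w (psi (g (Z_ j w)) ^+ k)%:E)%E @[j --> \oo] -->
      (\int[P]_w (psi (g (Z w)) ^+ k)%:E)%E.
    move=> mZ_ mZ cZ; apply: cvg_bounded_expectation => //.
    - by move=> j; exact: mcomp.
    - exact: mcomp.
    - apply: filterS cZ => w cZw.
      apply: (cvg_comp _ (fun u => u ^+ k)); last exact: exprn_continuous.
      by apply: (cvg_comp _ psi); [exact: cg|exact: cpsi].
  have hX := h _ _ mX_ mX cX; have hY := h _ _ mY_ mY cY.
  apply: (cvg_unique (@ereal_hausdorff R) hX).
  rewrite (_ : (fun j => _) = (fun j => \int[P]_w (psi (g (Y_ j w)) ^+ k)%:E)%E).
    exact: hY.
  apply/funext => j.
  apply: (same_law_integral (f := fun x => psi (g x) ^+ k)) => //.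
  - by apply: measurable_funX; apply: (measurableT_comp mpsi).
  - by move=> x; have /andP[] := psik01 k (g x).
have lim_k (Z : T -> E) (mZ : measurable_fun setT Z) :
    (\int[P]_w (psi (g (Z w)) ^+ k)%:E)%E @[k --> \oo] -->
    law P mZ [set x | g x <= 0].
  have mA : measurable [set w | g (Z w) <= 0].
    rewrite (_ : [set w | _] = setT `&` (g \o Z) @^-1` `]-oo, 0]).
      exact: (measurableT_comp mg mZ).
    by rewrite setTI; apply/seteqP; split=> x /=; rewrite in_itv.
  rewrite (_ : law P mZ _ = (\int[P]_w (\1_[set w | g (Z w) <= 0] w)%:E)%E).
    apply: cvg_bounded_expectation => //.
    - by move=> k; exact: mcomp.
    - apply: aeW => w; rewrite indicE; case: (leP (g (Z w)) 0) => gz.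
        rewrite mem_set// (_ : psi _ = 1); last first.
          by rewrite /psi (max_idPr gz) oppr0 expR0.
        by under eq_cvg do rewrite expr1n; exact: cvg_cst.
      rewrite memNset; last by move=> /=; rewrite leNgt gz.
      apply: cvg_expr; rewrite ger0_norm ?expR_ge0//.
      by rewrite /psi -expR0 ltr_expR oppr_lt0 lt_max gz.
  by rewrite integral_indic// setIT.
have hX := lim_k _ mX; have hY := lim_k _ mY.
apply: (cvg_unique (@ereal_hausdorff R) hX).
rewrite (_ : (fun k => _) = (fun k => \int[P]_w (psi (g (Y w)) ^+ k)%:E)%E).
  exact: hY.
by apply/funext => k; exact: lim_psi.
Qed.

End laws_on_colvec.

(** * Moments of Gaussian laws *)

Section integral_density.
Context d (T : measurableType d) (R : realType).
Variables (mu nu : {measure set T -> \bar R}) (p : T -> R).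
Hypotheses (mp : measurable_fun setT p) (p0 : forall x, 0 <= p x).
Hypothesis nuE : forall A, measurable A -> nu A = (\int[mu]_(x in A) (p x)%:E)%E.
Local Open Scope ereal_scope.
Import HBNNSimple.

(** Monotone convergence along simple functions reduces the claim to indicators, where it is
    [nuE]. *)
Lemma ge0_integral_density (f : T -> \bar R) :
  measurable_fun setT f -> (forall x, 0 <= f x) ->
  \int[nu]_x f x = \int[mu]_x (f x * (p x)%:E).
Proof.
move=> mf f0; pose h := nnsfun_approx measurableT mf.
have mEp : measurable_fun setT (EFin \o p) by exact/measurable_EFinP.
have p0' x : 0 <= (EFin \o p) x by rewrite lee_fin.
have -> : \int[nu]_x f x = limn (fun n => \int[nu]_x (EFin \o h n) x).
  have fE x : f x = limn ((EFin \o h ^~ x)).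
    by apply/esym/cvg_lim => //; exact: cvg_nnsfun_approx.
  under eq_integral => x _ do rewrite fE.
  apply: monotone_convergence => //.
  - by move=> n; exact/measurable_EFinP/measurable_funP.
  - by move=> n x _; rewrite lee_fin.
  - by move=> x _ a b ab; rewrite lee_fin; exact/lefP/nd_nnsfun_approx.
have -> : \int[mu]_x (f x * (p x)%:E) =
    limn (fun n => \int[mu]_x ((h n x)%:E * (p x)%:E)).
  have fE x : f x * (p x)%:E = limn (fun n => (h n x)%:E * (p x)%:E).
    apply/esym/cvg_lim => //; apply: cvgeZr => //.
    exact: cvg_nnsfun_approx.
  under eq_integral => x _ do rewrite fE.
  apply: monotone_convergence => //.
  - by move=> n; apply: emeasurable_funM => //; exact/measurable_EFinP.
  - by move=> n x _; rewrite mule_ge0// lee_fin.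
  - move=> x _ a b ab; rewrite lee_wpmul2r ?lee_fin//.
    exact/lefP/nd_nnsfun_approx.
apply/congr_lim/funext => n.
transitivity (\int[nu]_x
   (\sum_(y \in range (h n)) (y * \1_(h n @^-1` [set y]) x)%:E)).
  by apply: eq_integral => t _; rewrite /= fimfunE -fsumEFin.
have mind r : measurable_fun setT (fun x => (r * \1_(h n @^-1` [set r]) x)%:E).
  by apply/measurable_EFinP; exact: measurable_funM.
rewrite ge0_integral_fsum//; last by move=> m y _; exact: nnfun_muleindic_ge0.
transitivity (\int[mu]_x (\sum_(y \in range (h n))
    (y * \1_(h n @^-1` [set y]) x)%:E * (p x)%:E)); last first.
  apply: eq_integral => x _.
  rewrite -ge0_mule_fsuml => [|y]; last exact: nnfun_muleindic_ge0.
  by rewrite fsumEFin // -(fimfunE _ x).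
rewrite ge0_integral_fsum//; last 2 first.
- by move=> y; exact: emeasurable_funM.
- by move=> m y _; apply: mule_ge0; [exact: nnfun_muleindic_ge0|exact: p0'].
apply: eq_fsbigr => r rhn.
have r0 : (0 <= r)%R by move: rhn; rewrite inE => -[t _ <-].
under eq_integral do rewrite EFinM.
rewrite integralZl_indic_nnsfun => //.
under [RHS]eq_integral do rewrite EFinM -muleA.
rewrite ge0_integralZl//; last first.
  by move=> t _; rewrite mule_ge0// lee_fin.
- by apply: emeasurable_funM => //; exact/measurable_EFinP.
congr (_ * _); rewrite integral_indic// setIT nuE//.
rewrite integral_mkcond; apply: eq_integral => x _.
by rewrite epatch_indic muleC.
Qed.

End integral_density.

Section standard_normal.
Context {R : realType}.
Local Notation mu := (@lebesgue_measure R).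
Local Notation phi := (normal_pdf (0 : R) 1).

Lemma normal_pdf01E (x : R) :
  phi x = normal_peak 1 * expR (- (x ^+ 2 / 2)).
Proof.
rewrite normal_pdfE ?oner_neq0// /normal_fun subr0 expr1n.
by rewrite mulNr mulr2n.
Qed.

Lemma normal_pdf01N (x : R) : phi (- x) = phi x.
Proof. by rewrite !normal_pdf01E sqrrN. Qed.

Lemma is_derive_normal_pdf01 (x : R) : is_derive x (1 : R) phi (- (x * phi x)).
Proof.
have -> : phi = (fun x => normal_peak 1 * expR (- (x ^+ 2 / 2))).
  by apply/funext => y; rewrite normal_pdf01E.
apply: is_derive_eq.
by rewrite /GRing.scale/=; field.
Qed.

Lemma continuous_normal_pdf01 : continuous phi.
Proof. exact/continuous_normal_pdf/oner_neq0. Qed.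

Lemma continuous_expn_normal_pdf01 k : continuous (fun x : R => x ^+ k * phi x).
Proof.
move=> x; apply: cvgM; first exact: exprn_continuous.
exact: continuous_normal_pdf01.
Qed.

Lemma measurable_expn_normal_pdf01 k :
  measurable_fun setT (fun x : R => x ^+ k * phi x).
Proof.
by apply: measurable_funM; [exact: measurable_funX|exact: measurable_normal_pdf].
Qed.

(** The boundary term of the integration by parts below. From [e^x >= x] at [x = n^2 / 2] it is at
    most [2 * normal_peak 1 / n]. *)
Lemma cvg_n_normal_pdf01 : (n.+1%:R * phi n.+1%:R) @[n --> \oo] --> (0 : R).
Proof.
apply: (@squeeze_cvgr _ _ _ _ (cst 0)
  (fun n => 2 * normal_peak 1 * harmonic n)); first last.
- rewrite -[X in _ --> X](mulr0 (2 * normal_peak (1 : R))).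
  by apply: cvgM; [exact: cvg_cst|exact: cvg_harmonic].
- exact: cvg_cst.
apply: nearW => n /=.
have n0 : (0 : R) < n.+1%:R by rewrite ltr0n.
apply/andP; split; first by rewrite mulr_ge0 ?ler0n// normal_pdf_ge0.
rewrite normal_pdf01E mulrCA.
have -> : 2 * normal_peak 1 * n.+1%:R^-1 =
    normal_peak 1 * (2 * n.+1%:R^-1) :> R by ring.
rewrite ler_wpM2l ?normal_peak_ge0//.
rewrite expRN ler_pdivrMr ?expR_gt0//.
have h : n.+1%:R ^+ 2 / 2 <= expR (n.+1%:R ^+ 2 / 2 : R).
  by apply: le_trans (expR_ge1Dx _); rewrite lerDr.
apply: (@le_trans _ _ (2 * n.+1%:R^-1 * (n.+1%:R ^+ 2 / 2))).
  by rewrite le_eqVlt; apply/orP; left; apply/eqP; field; rewrite gt_eqF.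
by rewrite ler_wpM2l// mulr_ge0// invr_ge0 ltW.
Qed.

Lemma integral0y_normal_pdf01 : (\int[mu]_(x in `[0%R, +oo[) (phi x)%:E = 2^-1%:E)%E.
Proof.
have := @integral_normal_pdf R 0 1.
rewrite ge0_symfun_integralT//; last 3 first.
- by move=> x; exact: normal_pdf_ge0.
- exact: continuous_normal_pdf01.
- by move=> x /=; rewrite normal_pdf01N.
rewrite (_ : [set x | _] = `[0%R, +oo[%classic); last first.
  by apply/seteqP; split => x/=; rewrite in_itv/= andbT.
move=> h; have : (2^-1%:E * (2%:E * \int[mu]_(x in `[0%R, +oo[) (phi x)%:E) =
  2^-1%:E * 1 :> \bar R)%E by rewrite h.
by rewrite muleA -EFinM mulVf// mul1e mule1.
Qed.

(** Since [phi' = - x phi], the derivative of [x phi] is [phi - x^2 phi]; integrate over [[0, n]]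
    and let [n] grow. *)
Lemma integral0y_sqr_normal_pdf01 :
  (\int[mu]_(x in `[0%R, +oo[) (x ^+ 2 * phi x)%:E = 2^-1%:E)%E.
Proof.
have phi0 x : 0 <= phi x by exact: normal_pdf_ge0.
have h0 := @ge0_cvgn_integral R mu _ phi0 (measurable_normal_pdf 0 1).
have sphi0 x : 0 <= x ^+ 2 * phi x by rewrite mulr_ge0 ?sqr_ge0.
have h2 := @ge0_cvgn_integral R mu _ sphi0 (measurable_expn_normal_pdf01 2).
have key n : (\int[mu]_(x in `[0%R, n.+1%:R]) (x ^+ 2 * phi x)%:E =
    \int[mu]_(x in `[0%R, n.+1%:R]) (phi x)%:E - (n.+1%:R * phi n.+1%:R)%:E)%E.
  have int k : mu.-integrable `[0, n.+1%:R] (fun x : R => (x ^+ k * phi x)%:E).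
    apply: continuous_compact_integrable; first exact: segment_compact.
    by apply: continuous_subspaceT; exact: continuous_expn_normal_pdf01.
  have int0 : mu.-integrable `[0, n.+1%:R] (fun x : R => (phi x)%:E).
    apply: eq_integrable (int 0%N) => // x _.
    by rewrite expr0 mul1r.
  have Gd (x : R) : is_derive x (1 : R) (fun x => x * phi x) (phi x - x ^+ 2 * phi x).
    have := is_derive_normal_pdf01 x => ?.
    by apply: is_derive_eq; rewrite /GRing.scale/=; ring.
  have := @continuous_FTC2 R (fun x => phi x - x ^+ 2 * phi x)
    (fun x => x * phi x) 0 n.+1%:R.
  rewrite mul0r sube0 => FTC.
  rewrite -FTC ?ltr0n//; last 3 first.
  - apply: continuous_subspaceT => x; apply: cvgB.
      exact: continuous_normal_pdf01.
    exact: continuous_expn_normal_pdf01.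
  - split => [x _| |].
    + by have [] := Gd x.
    + apply: cvg_at_right_filter; apply: (continuous_expn_normal_pdf01 (k := 1)).
    + apply: cvg_at_left_filter; apply: (continuous_expn_normal_pdf01 (k := 1)).
  - by move=> x _; rewrite derive1E; have [_ ->] := Gd x.
  under [X in (_ = _ - X)%E]eq_integral do rewrite EFinB.
  rewrite (integralB _ int0 (int 2%N))//.
  have subeK' (u v : \bar R) : u \is a fin_num -> v \is a fin_num ->
      v = (u - (u - v))%E.
    by move: u v => [u| |] [v| |] //= _ _; rewrite -!EFinB; congr EFin; ring.
  apply: subeK'; apply: integrable_fin_num => //; exact: int.
have l1 : (\int[mu]_(x in `[0%R, n.+1%:R]) (phi x)%:E)%E @[n --> \oo] -->
    (2^-1)%:E.
  by have := h0; rewrite integral0y_normal_pdf01 -cvg_shiftS.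
have l2 : (n.+1%:R * phi n.+1%:R)%:E @[n --> \oo] --> (0 : R)%:E.
  by apply: cvg_EFin; [exact: nearW|exact: cvg_n_normal_pdf01].
have h : (\int[mu]_(x in `[0%R, n.+1%:R]) (phi x)%:E -
    (n.+1%:R * phi n.+1%:R)%:E)%E @[n --> \oo] --> ((2^-1)%:E - (0 : R)%:E)%E.
  exact: cvgeB.
move: h2; rewrite -cvg_shiftS/=; under eq_cvg do rewrite key; move=> h2.
by rewrite -(cvg_lim _ h2)// (cvg_lim _ h)// sube0.
Qed.

(** Folding the line onto the half-line turns [b] into [- b] on one side, so the cross term cancels
    and the first absolute moment never appears. The affine form is the one met after conditioning,
    with [a] and [b] frozen random variables. *)
Lemma integral_normal_prob_affine_sqr (a b : R) :
  (\int[normal_prob (0 : R) 1]_x ((a + b * x) ^+ 2)%:E = (a ^+ 2 + b ^+ 2)%:E)%E.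
Proof.
pose f (a b x : R) := (a + b * x) ^+ 2 * phi x.
have f0 c e x : 0 <= f c e x by rewrite mulr_ge0 ?sqr_ge0// normal_pdf_ge0.
have cf c e : continuous (f c e).
  move=> x; apply: cvgM; last exact: continuous_normal_pdf01.
  apply: (cvg_comp _ (fun u => u ^+ 2)); last exact: exprn_continuous.
  by apply: cvgD; [exact: cvg_cst|apply: cvgM; [exact: cvg_cst|exact: cvg_id]].
have mf c e : measurable_fun setT (f c e) by exact: continuous_measurable_fun.
rewrite (@ge0_integral_density _ _ R mu (normal_prob 0 1) phi)//; last 4 first.
- exact: measurable_normal_pdf.
- by move=> x; exact: normal_pdf_ge0.
- apply/measurable_EFinP; apply: measurable_funX; exact: measurable_funD.
- by move=> x; rewrite lee_fin sqr_ge0.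
transitivity (\int[mu]_x (f a b x)%:E)%E; first by [].
have -> : [set: R] = `]-oo, 0%R[%classic `|` `[0%R, +oo[%classic.
  by rewrite (itv_setU_setT true).
rewrite ge0_integral_setU//=; last 3 first.
- by apply/measurable_EFinP/measurable_funTS; exact: mf.
- by move=> x _; rewrite lee_fin.
- apply/disj_setPS => x [] /=; rewrite !in_itv/= andbT => xlt.
  by move=> /(lt_le_trans xlt); rewrite ltxx.
rewrite integral_itv_bndo_bndc; last first.
  by apply/measurable_EFinP/measurable_funTS; exact: mf.
have := @ge0_integration_by_substitutionNy R (f a b) 0.
rewrite oppr0 => ->//; last first.
  by apply: continuous_subspaceT; exact: cf.
have -> : f a b \o -%R = f a (- b).
  by apply/funext => x; rewrite /f/= normal_pdf01N mulrN mulNr.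
rewrite -ge0_integralD//; last 4 first.
- by move=> x _; rewrite lee_fin.
- by apply/measurable_EFinP/measurable_funTS; exact: mf.
- by move=> x _; rewrite lee_fin.
- by apply/measurable_EFinP/measurable_funTS; exact: mf.
transitivity (\int[mu]_(x in `[0%R, +oo[) ((2 * a ^+ 2)%:E * (phi x)%:E +
    (2 * b ^+ 2)%:E * (x ^+ 2 * phi x)%:E))%E.
  by apply: eq_integral => x _; rewrite -!EFinM -!EFinD /f; congr EFin; ring.
have phi0 x : 0 <= phi x by exact: normal_pdf_ge0.
have sphi0 x : 0 <= x ^+ 2 * phi x by rewrite mulr_ge0 ?sqr_ge0.
have c0 (c : R) : 0 <= 2 * c ^+ 2 by rewrite mulr_ge0 ?sqr_ge0.
rewrite ge0_integralD//; last 4 first.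
- by move=> x _; rewrite -EFinM lee_fin mulr_ge0.
- apply/measurable_EFinP/measurable_funTS; apply: measurable_funM => //.
  exact: measurable_normal_pdf.
- by move=> x _; rewrite -EFinM lee_fin mulr_ge0.
- apply/measurable_EFinP/measurable_funTS; apply: measurable_funM => //.
  exact: (measurable_expn_normal_pdf01 2).
rewrite !ge0_integralZl_EFin//; last 4 first.
- by move=> x _; rewrite lee_fin.
- by apply/measurable_EFinP/measurable_funTS; exact: (measurable_expn_normal_pdf01 2).
- by move=> x _; rewrite lee_fin.
- by apply/measurable_EFinP/measurable_funTS; exact: measurable_normal_pdf.
rewrite integral0y_normal_pdf01 integral0y_sqr_normal_pdf01.
by rewrite -!EFinM -EFinD; congr EFin; field.
Qed.

End standard_normal.

Section gaussian_laws.
Context {R : realType} (n : nat).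
Local Notation E := 'cV[R]_n.

Lemma std_gaussian_unique (gamma gamma' : probability E R) :
  std_gaussian gamma -> std_gaussian gamma' ->
  forall A, measurable A -> gamma A = gamma' A.
Proof.
by move=> g g'; apply: colvec_rectangle_ext => B mB; rewrite g// g'.
Qed.

Lemma std_gaussian_coord (gamma : probability E R) (i : 'I_n) (B : set R) :
  std_gaussian gamma -> measurable B ->
  gamma [set x | B (x i ord0)] = normal_prob 0 1 B.
Proof.
move=> g mB; have := g (fun j => if j == i then B else setT).
rewrite (_ : [set x | _] = [set x : E | B (x i ord0)]); last first.
  apply/seteqP; split=> x /=; first by move=> /(_ i); rewrite eqxx.
  by move=> Bx j; case: eqP => // ->.
move=> ->; last by move=> j; case: ifP.
rewrite (bigD1 i)//= eqxx big1 ?mule1// => j /negbTE ->.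
exact: probability_setT.
Qed.

Lemma std_gaussian_affine_sqr (gamma : probability E R) (i : 'I_n) (a b : R) :
  std_gaussian gamma ->
  (\int[gamma]_z ((a + b * z i ord0) ^+ 2)%:E = (a ^+ 2 + b ^+ 2)%:E)%E.
Proof.
move=> g; rewrite -integral_normal_prob_affine_sqr.
pose f (x : measurableTypeR R) := ((a + b * x) ^+ 2)%:E.
pose ci (x : E) : measurableTypeR R := x i ord0.
have mci : measurable_fun setT ci by exact: measurable_colvec_coord.
have mf : measurable_fun setT f.
  by apply/measurable_EFinP; apply: measurable_funX; exact: measurable_funD.
have f0 y : (0 <= f y)%E by rewrite lee_fin sqr_ge0.
rewrite -[LHS](ge0_integral_distribution (P := gamma) (mfun_of mci) mf f0).
by apply: eq_measure_integral => A mA _; exact: std_gaussian_coord.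
Qed.

Context d (T : measurableType d) (P : probability T R).

(** The covariance is written [c ^+ 2 *: A] so that its only positive semidefinite square root is
    [c *: A]. It covers both the increments of [W] and the singular initial law. *)
Lemma is_gaussian_idempotent (X : T -> E) (c : R) (A : 'M[R]_n) :
  0 <= c -> A *m A = A -> A^T = A ->
  is_gaussian (pushforward P X) 0 (c ^+ 2 *: A) ->
  exists2 gamma : probability E R, std_gaussian gamma &
    forall B, measurable B ->
      P (X @^-1` B) = gamma ((fun z => (c *: A) *m z) @^-1` B).
Proof.
move=> c0 AA AT [gamma [S [g pS SS gX]]]; exists gamma => // B mB.
have := gX B mB; rewrite /pushforward => ->.
rewrite (psd_sqrt_idempotent pS c0 AA AT SS).
by under eq_fun do rewrite add0r.
Qed.

Lemma is_gaussian_scalar_affine_sqr (X : T -> E) (q : R) (i : 'I_n) (a b : R) :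
  0 <= q -> measurable_fun setT X -> is_gaussian (pushforward P X) 0 q%:M ->
  (\int[P]_w ((a + b * X w i ord0) ^+ 2)%:E = (a ^+ 2 + b ^+ 2 * q)%:E)%E.
Proof.
move=> q0 mX gX.
have [||||gamma g Xg] := @is_gaussian_idempotent X (Num.sqrt q) 1%:M.
- exact: sqrtr_ge0.
- by rewrite mulmx1.
- by rewrite trmx1.
- by rewrite sqr_sqrtr// scalemx1.
pose f (x : E) := ((a + b * x i ord0) ^+ 2)%:E.
have mf : measurable_fun setT f.
  apply/measurable_EFinP; apply: measurable_funX; apply: measurable_funD => //.
  by apply: measurable_funM => //; exact: measurable_colvec_coord.
have f0 y : (0 <= f y)%E by rewrite lee_fin sqr_ge0.
rewrite -[LHS](ge0_integral_distribution (mfun_of mX) mf f0).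
pose s (z : E) := (Num.sqrt q *: 1%:M) *m z.
have ms : measurable_fun setT s.
  by apply: measurable_colvec_mulmx; exact: measurable_id.
transitivity (\int[law gamma ms]_y f y)%E.
  by apply: eq_measure_integral => A mA _; exact: Xg.
rewrite (ge0_integral_distribution (mfun_of ms) mf f0).
transitivity (\int[gamma]_z ((a + b * Num.sqrt q * z i ord0) ^+ 2)%:E)%E.
  apply: eq_integral => z _; rewrite /f/= /s -scalemxAl mul1mx mxE.
  by rewrite mulrA.
by rewrite std_gaussian_affine_sqr// exprMn sqr_sqrtr.
Qed.

Lemma is_gaussian_proj_same_law (X Z : T -> E) (A : 'M[R]_n) :
  measurable_fun setT X -> A *m A = A -> A^T = A ->
  is_gaussian (pushforward P X) 0 1%:M ->
  is_gaussian (pushforward P Z) 0 A ->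
  same_law P Z (fun w => A *m X w).
Proof.
move=> mX AA AT gX gZ B mB.
have [||||gamma g Xg] := @is_gaussian_idempotent X 1 1%:M.
- exact: ler01.
- by rewrite mulmx1.
- by rewrite trmx1.
- by rewrite expr1n scale1r.
have [||||gamma' g' Zg] := @is_gaussian_idempotent Z 1 A => //.
  by rewrite expr1n scale1r.
have mA : measurable_fun setT (fun z : E => A *m z).
  by apply: measurable_colvec_mulmx; exact: measurable_id.
have mAB : measurable ((fun z : E => A *m z) @^-1` B).
  by rewrite -[X in measurable X]setTI; exact: mA.
rewrite Zg// scale1r (std_gaussian_unique g' g)//.
have := Xg _ mAB; rewrite /preimage/= => ->.
by congr (gamma _); apply/funext => z /=; rewrite scale1r mul1mx.
Qed.

End gaussian_laws.

(** * Sums against Brownian increments *)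

Section second_moment.
Context d (T : measurableType d) (R : realType) (P : probability T R).
Context (G : set (set T)) (sG : sigma_algebra setT G) (Gm : G `<=` measurable).

Lemma measurable_wrt_add_mul (V eta D : T -> R) :
  measurable_wrt G V -> measurable_wrt G eta -> measurable_wrt G D ->
  measurable_wrt G (fun w => V w + eta w * D w).
Proof.
move=> /(measurable_wrtP sG) mV /(measurable_wrtP sG) me /(measurable_wrtP sG) mD.
apply/(measurable_wrtP sG); apply: measurable_funD => //.
exact: measurable_funM.
Qed.

(** With [V] and [eta] frozen by independence, the centred variable [D_i] contributes no cross term.
    All terms are nonnegative extended reals, so [V] and [eta] need not be square integrable. *)
Lemma second_moment_step n (V eta : T -> R) (D : T -> 'cV[R]_n) (i : 'I_n)
    (q : R) :
  measurable_wrt G V -> measurable_wrt G eta -> measurable_fun setT D ->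
  independent_of P G D -> 0 <= q -> is_gaussian (pushforward P D) 0 q%:M ->
  (\int[P]_w ((V w + eta w * D w i ord0) ^+ 2)%:E =
   \int[P]_w ((V w) ^+ 2)%:E + q%:E * \int[P]_w ((eta w) ^+ 2)%:E)%E.
Proof.
move=> GV Geta mD iD q0 gD.
have GX : measurable_wrt G (fun w => (V w, eta w)).
  apply/(measurable_wrtP sG).
  by apply: measurable_fun_pair; apply/(measurable_wrtP sG).
have mX := measurable_wrt_measurable Gm GX.
have mV := measurable_wrt_measurable Gm GV.
have meta := measurable_wrt_measurable Gm Geta.
pose f (z : (R * R) * 'cV[R]_n) := (z.1.1 + z.1.2 * z.2 i ord0) ^+ 2.
have mf : measurable_fun setT f.
  apply: measurable_funX; apply: measurable_funD.
    exact: (measurableT_comp measurable_fst measurable_fst).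
  apply: measurable_funM.
    exact: (measurableT_comp measurable_snd measurable_fst).
  exact: (measurableT_comp (measurable_colvec_coord i) measurable_snd).
have f0 z : 0 <= f z by exact: sqr_ge0.
rewrite [LHS](independent_tonelli mf f0 mX mD GX iD) /f/=.
under eq_integral do rewrite (is_gaussian_scalar_affine_sqr i _ _ q0 mD gD)
  EFinD [X in (_ + X)%E]EFinM muleC.
rewrite ge0_integralD//; last 4 first.
- by move=> x _; rewrite lee_fin sqr_ge0.
- by apply/measurable_EFinP; exact: measurable_funX.
- by move=> x _; rewrite -EFinM lee_fin mulr_ge0 ?sqr_ge0.
- by apply/measurable_EFinP; apply: measurable_funM => //; exact: measurable_funX.
rewrite ge0_integralZl_EFin//.
- by move=> x _; rewrite lee_fin sqr_ge0.
- by apply/measurable_EFinP; exact: measurable_funX.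
Qed.

End second_moment.

Section brownian_sums.
Context d (T : measurableType d) (R : realType) (P : probability T R)
  (F : R -> set (set T)) (m : nat) (W : R -> T -> 'cV[R]_m).
Hypotheses (hF : is_filtration F) (hW : is_brownian P F W).

Definition increment (s t : R) (w : T) : 'cV[R]_m := W t w - W s w.

Lemma measurable_wrt_filtration s t d' (E : measurableType d') (X : T -> E) :
  0 <= s -> s <= t -> measurable_wrt (F s) X -> measurable_wrt (F t) X.
Proof. by move=> s0 st; apply: measurable_wrt_sub; exact: filtration_mono. Qed.

Lemma measurable_increment s t : 0 <= s -> s <= t ->
  measurable_wrt (F t) (increment s t).
Proof.
move=> s0 st; have t0 := le_trans s0 st.
have sF := filtration_sigma hF t0.
have /(measurable_wrtP sF) mt := bm_adapted hW t0.
have /(measurable_wrtP sF) ms :=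
  measurable_wrt_filtration s0 st (bm_adapted hW s0).
apply/(measurable_wrtP sF); apply: measurable_colvecD => //.
rewrite (_ : (fun _ => _) = (fun w => (-1) *: W s w)).
  exact: measurable_colvecZ.
by apply/funext => w; rewrite scaleN1r.
Qed.

Context (n : nat) (tt : nat -> R).
Hypotheses (tt0 : 0 <= tt 0) (ttS : forall k, (k < n)%N -> tt k <= tt k.+1).

Lemma times_ge0 k : (k <= n)%N -> 0 <= tt k.
Proof.
elim: k => // k IH kn; apply: (le_trans (IH (ltnW kn))); exact: ttS.
Qed.

(** Scalar sums with random coefficients serve for second moments, in particular of simple
    processes; [wiener_sum], with deterministic matrix coefficients, serves for laws. *)
Definition ito_sum (i : 'I_m) (V0 : T -> R) (eta : nat -> T -> R) k (w : T) : R :=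
  V0 w + \sum_(j < k) eta j w * increment (tt j) (tt j.+1) w i ord0.

Lemma measurable_ito_sum i V0 eta k : (k <= n)%N ->
  measurable_wrt (F (tt 0)) V0 ->
  (forall j, (j < n)%N -> measurable_wrt (F (tt j)) (eta j)) ->
  measurable_wrt (F (tt k)) (ito_sum i V0 eta k).
Proof.
move=> + mV0 meta; elim: k => [_|k IH kn].
  by rewrite /ito_sum; under eq_fun do rewrite big_ord0 addr0.
rewrite (_ : ito_sum _ _ _ _ = (fun w => ito_sum i V0 eta k w +
    eta k w * increment (tt k) (tt k.+1) w i ord0)); last first.
  by apply/funext => w; rewrite /ito_sum big_ord_recr/= addrA.
have tk0 := times_ge0 (ltnW kn).
have sF := filtration_sigma hF (times_ge0 kn).
apply: measurable_wrt_add_mul => //.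
- exact: measurable_wrt_filtration tk0 (ttS kn) (IH (ltnW kn)).
- exact: measurable_wrt_filtration tk0 (ttS kn) (meta _ kn).
- apply/(measurable_wrtP sF).
  have /(measurable_wrtP sF) mi := measurable_increment tk0 (ttS kn).
  exact: (measurableT_comp (measurable_colvec_coord i) mi).
Qed.

(** The discrete Ito isometry, with [V0] as an additional orthogonal term: each partial sum is
    measurable at the start of the next increment, so [second_moment_step] applies. *)
Lemma ito_sum_isometry i V0 eta :
  measurable_wrt (F (tt 0)) V0 ->
  (forall j, (j < n)%N -> measurable_wrt (F (tt j)) (eta j)) ->
  (\int[P]_w ((ito_sum i V0 eta n w) ^+ 2)%:E =
   \int[P]_w ((V0 w) ^+ 2)%:E +
   \sum_(j < n) (tt j.+1 - tt j)%:E * \int[P]_w ((eta j w) ^+ 2)%:E)%E.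
Proof.
move=> mV0 meta.
suff H k : (k <= n)%N -> (\int[P]_w ((ito_sum i V0 eta k w) ^+ 2)%:E =
   \int[P]_w ((V0 w) ^+ 2)%:E +
   \sum_(j < k) (tt j.+1 - tt j)%:E * \int[P]_w ((eta j w) ^+ 2)%:E)%E.
  exact: H.
elim: k => [_|k IH kn].
  by rewrite /ito_sum big_ord0 adde0; under eq_integral do rewrite big_ord0 addr0.
have tk0 := times_ge0 (ltnW kn).
have tk1 := times_ge0 kn.
rewrite big_ord_recr/= addeA -(IH (ltnW kn)).
rewrite -(second_moment_step (filtration_sigma hF tk0) (filtration_sub hF tk0)
  (D := increment (tt k) (tt k.+1)) i).
- apply: eq_integral => w _.
  by rewrite /ito_sum big_ord_recr/= addrA.
- exact: measurable_ito_sum (ltnW kn) mV0 meta.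
- exact: meta.
- apply: measurable_wrt_measurable (measurable_increment tk0 (ttS kn)).
  exact: filtration_sub.
- exact: bm_indep hW _ _ tk0 (ttS kn).
- by rewrite subr_ge0 ttS.
- exact: bm_gaussian hW _ _ tk0 (ttS kn).
Qed.

Definition wiener_sum p (V0 : T -> 'cV[R]_p) (M : nat -> 'M[R]_(p, m)) k (w : T) :=
  V0 w + \sum_(j < k) M j *m increment (tt j) (tt j.+1) w.

Lemma wiener_sumS p (V0 : T -> 'cV[R]_p) M k w :
  wiener_sum V0 M k.+1 w =
  wiener_sum V0 M k w + M k *m increment (tt k) (tt k.+1) w.
Proof. by rewrite /wiener_sum big_ord_recr/= addrA. Qed.

Lemma measurable_wiener_sum p (V0 : T -> 'cV[R]_p) M k : (k <= n)%N ->
  measurable_wrt (F (tt 0)) V0 ->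
  measurable_wrt (F (tt k)) (wiener_sum V0 M k).
Proof.
move=> + mV0; elim: k => [_|k IH kn].
  by rewrite /wiener_sum; under eq_fun do rewrite big_ord0 addr0.
have tk0 := times_ge0 (ltnW kn).
have sF := filtration_sigma hF (times_ge0 kn).
rewrite (_ : wiener_sum _ _ _ = (fun w => wiener_sum V0 M k w +
    M k *m increment (tt k) (tt k.+1) w)); last first.
  by apply/funext => w; rewrite wiener_sumS.
apply/(measurable_wrtP sF).
apply: measurable_colvecD.
  apply/(measurable_wrtP sF).
  exact: measurable_wrt_filtration tk0 (ttS kn) (IH (ltnW kn)).
apply: measurable_colvec_mulmx; apply/(measurable_wrtP sF).
exact: measurable_increment tk0 (ttS kn).
Qed.

(** At each step the partial sum is measurable with respect to the past and the next increment is
    independent of it, so equality of laws propagates by [same_law_pair]. *)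
Lemma same_law_wiener_sum p (V0 V0' : T -> 'cV[R]_p) M :
  measurable_wrt (F (tt 0)) V0 -> measurable_wrt (F (tt 0)) V0' ->
  same_law P V0 V0' ->
  same_law P (wiener_sum V0 M n) (wiener_sum V0' M n).
Proof.
move=> mV0 mV0' V0V0'.
suff H k : (k <= n)%N ->
    same_law P (wiener_sum V0 M k) (wiener_sum V0' M k) by exact: H.
elim: k => [_|k IH kn].
  rewrite (_ : wiener_sum V0 M 0 = V0); last first.
    by apply/funext => w; rewrite /wiener_sum big_ord0 addr0.
  rewrite (_ : wiener_sum V0' M 0 = V0')//.
  by apply/funext => w; rewrite /wiener_sum big_ord0 addr0.
have tk0 := times_ge0 (ltnW kn).
pose phi (z : 'cV[R]_p * 'cV[R]_m) := z.1 + M k *m z.2.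
have mphi : measurable_fun setT phi.
  apply: measurable_colvecD; first exact: measurable_fst.
  by apply: measurable_colvec_mulmx; exact: measurable_snd.
have h V : wiener_sum V M k.+1 =
    (fun w => phi (wiener_sum V M k w, increment (tt k) (tt k.+1) w)).
  by apply/funext => w; rewrite wiener_sumS.
rewrite !h; apply: (same_law_pair (filtration_sub hF tk0) mphi).
- apply: measurable_wrt_measurable (measurable_increment tk0 (ttS kn)).
  exact: filtration_sub hF _ (times_ge0 kn).
- exact: measurable_wiener_sum (ltnW kn) _.
- exact: measurable_wiener_sum (ltnW kn) _.
- exact: bm_indep hW _ _ tk0 (ttS kn).
- exact: IH (ltnW kn).
Qed.

End brownian_sums.

(** * Ito integrals of constants *)

Lemma second_moment_le0_ae d (T : measurableType d) (R : realType)
    (P : probability T R) (X : T -> R) :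
  measurable_fun setT X -> (\int[P]_w ((X w) ^+ 2)%:E <= 0)%E ->
  {ae P, forall w, X w = 0}.
Proof.
move=> mX X0.
have mX2 : measurable_fun setT (fun w => ((X w) ^+ 2)%:E).
  by apply/measurable_EFinP; exact: measurable_funX.
have : (\int[P]_w `|((X w) ^+ 2)%:E| = 0)%E.
  under eq_integral do rewrite gee0_abs ?lee_fin ?sqr_ge0//.
  apply/eqP; rewrite eq_le X0/=; apply: integral_ge0 => w _.
  by rewrite lee_fin sqr_ge0.
move=> /(ae_eq_integral_abs P measurableT mX2) h.
apply: filterS h => w /(_ I) /= /eqP; rewrite eqe sqrf_eq0.
by move=> /eqP.
Qed.

(** Young's inequality [2 X Y <= e X^2 + Y^2 / e], in place of the triangle inequality in L2:
    [e = 1] gives the factors 2, and [e] tending to 0 compares second moments sharply. *)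
Lemma second_momentD_le d (T : measurableType d) (R : realType)
    (P : probability T R) (e : R) (X Y : T -> R) :
  0 < e -> measurable_fun setT X -> measurable_fun setT Y ->
  (\int[P]_w ((X w + Y w) ^+ 2)%:E <=
   (1 + e)%:E * \int[P]_w ((X w) ^+ 2)%:E +
   (1 + e^-1)%:E * \int[P]_w ((Y w) ^+ 2)%:E)%E.
Proof.
move=> e0 mX mY.
have mE (Z : T -> R) : measurable_fun setT Z ->
    measurable_fun setT (fun w => ((Z w) ^+ 2)%:E).
  by move=> mZ; apply/measurable_EFinP; exact: measurable_funX.
have pE (Z : T -> R) w : setT w -> (0 <= ((Z w) ^+ 2)%:E)%E.
  by move=> _; rewrite lee_fin sqr_ge0.
have e1 : 0 <= 1 + e by rewrite addr_ge0// ltW.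
have e2 : 0 <= 1 + e^-1 by rewrite addr_ge0// invr_ge0 ltW.
rewrite -!ge0_integralZl_EFin//; [|exact: pE|exact: mE|exact: pE|exact: mE].
rewrite -ge0_integralD//; last 4 first.
- by move=> w _; rewrite -EFinM lee_fin mulr_ge0 ?sqr_ge0.
- by apply: emeasurable_funM => //; exact: mE.
- by move=> w _; rewrite -EFinM lee_fin mulr_ge0 ?sqr_ge0.
- by apply: emeasurable_funM => //; exact: mE.
apply: ge0_le_integral => //.
- exact: pE.
- by apply: mE; exact: measurable_funD.
- by apply: emeasurable_funD; apply: emeasurable_funM => //; exact: mE.
- move=> w _; rewrite -!EFinM -EFinD lee_fin -subr_ge0.
  have -> : (1 + e) * X w ^+ 2 + (1 + e^-1) * Y w ^+ 2 - (X w + Y w) ^+ 2 =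
      (e * X w - Y w) ^+ 2 / e by field; rewrite gt_eqF.
  by rewrite divr_ge0 ?sqr_ge0// ltW.
Qed.

Section ito_integral_constant.
Context d (T : measurableType d) (R : realType) (P : probability T R)
  (F : R -> set (set T)) (m : nat) (W : R -> T -> 'cV[R]_m).
Hypotheses (hF : is_filtration F) (hW : is_brownian P F W).

Lemma sp_time_le t (S : simple_process F t) i j :
  (i <= j)%N -> (j <= sp_size S)%N -> sp_time S i <= sp_time S j.
Proof.
elim: j => [|j IH]; first by rewrite leqn0 => /eqP ->.
rewrite leq_eqVlt => /predU1P[->//|ij jS].
exact: le_trans (IH ij (ltnW jS)) (sp_time_mono jS).
Qed.

Lemma sp_time_find t (S : simple_process F t) s : 0 < s <= t ->
  exists k : 'I_(sp_size S), sp_time S k < s <= sp_time S k.+1.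
Proof.
move=> /andP[s0 st].
have H n : (n <= sp_size S)%N -> s <= sp_time S n ->
    exists k : 'I_(sp_size S), sp_time S k < s <= sp_time S k.+1.
  elim: n => [_|n IH nS sn]; first by rewrite sp_time0 leNgt s0.
  have [sn'|sn'] := leP s (sp_time S n); first exact: IH (ltnW nS) sn'.
  by exists (Ordinal nS); rewrite /= sn' sn.
by apply: (H (sp_size S)) => //; rewrite sp_timet.
Qed.

Lemma sp_interval_uniq t (S : simple_process F t) (i j : 'I_(sp_size S)) s :
  sp_time S i < s <= sp_time S i.+1 -> sp_time S j < s <= sp_time S j.+1 -> i = j.
Proof.
move=> /andP[i1 i2] /andP[j1 j2]; apply/val_inj/eqP; rewrite eqn_leq.
apply/andP; split; rewrite leqNgt; apply/negP => ij.
- have := sp_time_le ij (ltnW (ltn_ord i)).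
  by move=> /(le_trans j2) /(lt_le_trans i1); rewrite ltxx.
- have := sp_time_le ij (ltnW (ltn_ord j)).
  by move=> /(le_trans i2) /(lt_le_trans j1); rewrite ltxx.
Qed.

Lemma sp_valE t (S : simple_process F t) (k : 'I_(sp_size S)) s w :
  sp_time S k < s <= sp_time S k.+1 -> sp_val S s w = sp_coef S k w.
Proof.
move=> ks; rewrite /sp_val (bigD1 k)//= big1 ?addr0 => [|j jk].
  by rewrite indicE mem_set ?mulr1//= in_itv.
rewrite indicE memNset ?mulr0//= in_itv/= => js.
by move/eqP: jk; apply; exact: sp_interval_uniq js ks.
Qed.

Lemma sp_val0 t (S : simple_process F t) w : sp_val S 0 w = 0.
Proof.
rewrite /sp_val big1// => j _; rewrite indicE memNset ?mulr0//= in_itv/=.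
have := sp_time_le (leq0n j) (ltnW (ltn_ord j)).
by rewrite sp_time0 leNgt => /negbTE ->.
Qed.

(** The difference on the left is an [ito_sum] with coefficients [c - sp_coef S k] and zero initial
    value. Only this inequality is needed, which lets the contribution of the time 0 be discarded by
    sign. *)
Lemma sp_integral_isometry t (S : simple_process F t) (j : 'I_m) (c : R) :
  (\int[P]_w ((c * (W t w j ord0 - W 0 w j ord0) -
      sp_integral S (fun s w => W s w j ord0) w) ^+ 2)%:E <=
   \int[lebesgue_measure]_(s in `[0%R, t])
      \int[P]_w ((c - sp_val S s w) ^+ 2)%:E)%E.
Proof.
pose n := sp_size S; pose eta k w := c - sp_coef S k w.
have t00 : 0 <= sp_time S 0 by rewrite sp_time0.
have meta k : (k < n)%N -> measurable_wrt (F (sp_time S k)) (eta k).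
  move=> kn; have sF := filtration_sigma hF (times_ge0 t00 (@sp_time_mono _ _ _ _ _ S) (ltnW kn)).
  have /(measurable_wrtP sF) mc := sp_coef_adapted kn.
  by apply/(measurable_wrtP sF); exact: measurable_funB.
have mcst : measurable_wrt (F (sp_time S 0)) (cst (0 : R) : T -> R).
  by apply/(measurable_wrtP (filtration_sigma hF t00)); exact: measurable_cst.
have /(_ t00) := ito_sum_isometry hF hW (n := n) (tt := sp_time S) _
  (@sp_time_mono _ _ _ _ _ S) j mcst meta.
have -> : (\int[P]_w ((cst (0 : R) w) ^+ 2)%:E = 0)%E.
  by apply: integral0_eq => w _ /=; rewrite expr0n.
rewrite add0e.
rewrite (eq_integral (fun w => ((c * (W t w j ord0 - W 0 w j ord0) -
      sp_integral S (fun s w => W s w j ord0) w) ^+ 2)%:E)); last first.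
  move=> w _; congr ((_ ^+ 2)%:E); rewrite /ito_sum/= add0r.
  have -> : W t w j ord0 - W 0 w j ord0 =
      \sum_(k < n) (W (sp_time S k.+1) w j ord0 - W (sp_time S k) w j ord0).
    rewrite -(big_mkord xpredT (fun k => W (sp_time S k.+1) w j ord0 -
      W (sp_time S k) w j ord0)).
    rewrite (@telescope_sumr _ 0%N _ (fun k => W (sp_time S k) w j ord0))//.
    by rewrite sp_timet sp_time0.
  rewrite mulr_sumr -sumrB; apply: eq_bigr => k _.
  by rewrite /eta /increment !mxE mulrBl.
move=> ->.
pose g k (s : measurableTypeR R) : \bar R := ((\int[P]_w ((eta k w) ^+ 2)%:E) *
  (\1_(`]sp_time S k, sp_time S k.+1]) s)%:E)%E.
have eta0 k : (0 <= \int[P]_w ((eta k w) ^+ 2)%:E)%E.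
  by apply: integral_ge0 => w _; rewrite lee_fin sqr_ge0.
have mg k : measurable_fun setT (g k).
  by apply: emeasurable_funM => //; apply/measurable_EFinP; exact: measurable_indic.
have g0 k s : (0 <= g k s)%E by rewrite /g mule_ge0// lee_fin.
(* The intervals of a simple process are open on the left, so its value at [s = 0] is 0 and the
   integrand there is [c^2]. *)
have mh : measurable_fun setT (fun s : measurableTypeR R => ((c ^+ 2) * \1_[set 0] s)%:E).
  by apply/measurable_EFinP; apply: measurable_funM => //; exact: measurable_indic.
rewrite (eq_integral (fun s : measurableTypeR R => (\sum_(k < n) g k s +
    ((c ^+ 2) * \1_[set 0] s)%:E)%E)); last first.
  move=> s; rewrite inE/= in_itv/= => /andP[s0 st].
  move: s0; rewrite le_eqVlt => /predU1P[<-|s0].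
    rewrite big1 ?add0e; last first.
      move=> k _; rewrite /g indicE memNset ?mule0//= in_itv/=.
      have := sp_time_le (leq0n k) (ltnW (ltn_ord k)).
      by rewrite sp_time0 leNgt => /negbTE ->.
    rewrite indicE mem_set// mulr1 (eq_integral (cst (c ^+ 2)%:E)).
      by rewrite integral_cst// [X in (_ * X)%E]probability_setT mule1.
    by move=> w _; rewrite sp_val0 subr0.
  have [k ks] := @sp_time_find _ S s (introT andP (conj s0 st)).
  rewrite indicE memNset ?mulr0 ?adde0; last by move=> /= se; rewrite se ltxx in s0.
  rewrite (bigD1 k)//= big1 ?adde0 => [|i ik].
    rewrite /g indicE mem_set/= ?in_itv//= mule1.
    by apply: eq_integral => w _; rewrite (sp_valE w ks).
  rewrite /g indicE memNset ?mule0//= in_itv/= => is_.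
  by move/eqP: ik; apply; exact: sp_interval_uniq is_ ks.
rewrite ge0_integralD//; last 4 first.
- by move=> s _; apply: sume_ge0.
- by apply: measurable_funTS; apply: emeasurable_sum.
- by move=> s _; rewrite lee_fin mulr_ge0// sqr_ge0.
- exact: measurable_funTS.
apply: (@le_trans _ _ (\int[lebesgue_measure]_(s in `[0%R, t])
   \sum_(k < n) g k s)%E); last first.
  by rewrite leeDl// integral_ge0// => s _; rewrite lee_fin mulr_ge0// sqr_ge0.
rewrite ge0_integral_sum//; last by move=> k; exact: measurable_funTS.
apply: lee_sum => k _; rewrite /g ge0_integralZl//; last first.
  by apply/measurable_EFinP/measurable_funTS; exact: measurable_indic.
rewrite integral_indic// muleC lee_wpmul2l//.
have h : ((sp_time S k.+1 - sp_time S k)%:E <=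
    lebesgue_measure `]sp_time S k, sp_time S k.+1]%classic)%E.
  rewrite lebesgue_measure_itv/= lte_fin; case: ltP => // h.
  by rewrite lee_fin subr_le0.
rewrite setIidl; first exact: h.
move=> s /=; rewrite !in_itv/= => /andP[ks sk].
have k0 := sp_time_le (leq0n k) (ltnW (ltn_ord k)).
have k1 := sp_time_le (ltn_ord k) (leqnn _).
rewrite sp_time0 in k0; rewrite sp_timet in k1.
by rewrite (le_trans k0 (ltW ks)) (le_trans sk k1).
Qed.

(** The integrals of the approximating simple processes converge in L2 to [I] by assumption and to
    [c (W_t - W_0)] by the isometry. *)
Lemma ito_integral1_constant t (j : 'I_m) (phi : R -> T -> R) (c : R)
    (I : T -> R) :
  0 <= t -> (forall s w, 0 <= s <= t -> phi s w = c) ->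
  is_ito_integral1 P F (fun s w => W s w j ord0) t phi I ->
  {ae P, forall w, I w = c * (W t w j ord0 - W 0 w j ord0)}.
Proof.
move=> t0 phic [_ _ mI [S [S1 S2]]].
pose J w := c * (W t w j ord0 - W 0 w j ord0).
pose B s w := W s w j ord0.
have mB s : 0 <= s -> measurable_fun setT (B s).
  move=> s0; apply: (measurableT_comp (measurable_colvec_coord j)).
  exact: measurable_wrt_measurable (filtration_sub hF s0) (bm_adapted hW s0).
have mJ : measurable_fun setT J.
  apply: measurable_funM => //; apply: measurable_funB; exact: mB.
have mSI n : measurable_fun setT (sp_integral (S n) B).
  apply: measurable_sum => k.
  have k0 : 0 <= sp_time (S n) k.
    by rewrite -(sp_time0 (S n)); apply: sp_time_le => //; exact: ltnW.
  have k1 : 0 <= sp_time (S n) k.+1.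
    by rewrite -(sp_time0 (S n)); apply: sp_time_le.
  apply: measurable_funM; last by apply: measurable_funB; exact: mB.
  apply: measurable_wrt_measurable (sp_coef_adapted (ltn_ord k)).
  exact: filtration_sub hF _ k0.
have mIJ : measurable_fun setT (fun w => I w - J w) by exact: measurable_funB.
suff H : (\int[P]_w ((I w - J w) ^+ 2)%:E <= 0)%E.
  by apply: filterS (second_moment_le0_ae mIJ H) => w /eqP; rewrite subr_eq0 => /eqP.
(* The factors 2 are those of [second_momentD_le] at [e = 1]. *)
have lim0 : ((2%:E * \int[P]_w ((I w - sp_integral (S n) B w) ^+ 2)%:E +
    2%:E * \int[lebesgue_measure]_(s in `[0%R, t])
      \int[P]_w ((phi s w - sp_val (S n) s w) ^+ 2)%:E)%E
    @[n --> \oo] --> (2%:E * 0 + 2%:E * 0 : \bar R))%E.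
  apply: cvgeD; first by rewrite !mule0.
    exact: cvgeZl.
  exact: cvgeZl.
have -> : 0%E = (2%:E * 0 + 2%:E * 0 : \bar R)%E by rewrite !mule0 adde0.
rewrite -(cvg_lim (@ereal_hausdorff R) lim0).
apply: lime_ge; first by apply/cvg_ex; eexists; exact: lim0.
apply: nearW => n.
rewrite (eq_integral (fun w => ((I w - sp_integral (S n) B w +
    (sp_integral (S n) B w - J w)) ^+ 2)%:E)); last first.
  by move=> w _; congr ((_ ^+ 2)%:E); ring.
have two : 1 + 1^-1 = 2 :> R by rewrite invr1.
apply: (le_trans (second_momentD_le P ltr01 _ _)).
- exact: measurable_funB.
- exact: measurable_funB.
rewrite two; apply: leeD => //; apply: lee_wpmul2l => //.
rewrite (eq_integral (fun w => ((J w - sp_integral (S n) B w) ^+ 2)%:E)); last first.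
  by move=> w _; rewrite -sqrrN opprB.
apply: (le_trans (sp_integral_isometry (S n) j c)).
rewrite le_eqVlt; apply/orP; left; apply/eqP.
apply: eq_integral => s; rewrite inE/= in_itv/= => st.
by apply: eq_integral => w _; rewrite phic.
Qed.

End ito_integral_constant.

(** * The exponential Euler scheme *)

Section exponential_scheme.
Context {R : realType}.
Local Notation mu := (@lebesgue_measure R).

Definition grid (t : R) (n k : nat) : R := k%:R * (t / n%:R).

Lemma grid0 t n : grid t n 0 = 0. Proof. exact: mul0r. Qed.

Lemma gridn t n : (0 < n)%N -> grid t n n = t.
Proof. by move=> n0; rewrite /grid mulrC divfK// pnatr_eq0 -lt0n. Qed.

Lemma gridS t n k : grid t n k.+1 = grid t n k + t / n%:R.
Proof. by rewrite /grid -natr1 mulrDl mul1r. Qed.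

Lemma grid_le t n j k : 0 <= t -> (j <= k)%N -> grid t n j <= grid t n k.
Proof. by move=> t0 jk; rewrite ler_wpM2r ?divr_ge0// ler_nat. Qed.

Lemma grid_ge0 t n k : 0 <= t -> 0 <= grid t n k.
Proof. by move=> t0; rewrite mulr_ge0// divr_ge0. Qed.

(** Left-point sums for the variation of constants formula, in which [e^(-(t - s))] is integrated
    against [dw_s]. *)
Definition exp_scheme (t : R) (n : nat) (x0 : R) (w : R -> R) : R :=
  expR (- t) * x0 + \sum_(k < n) expR (- (t - grid t n k)) *
    (w (grid t n k.+1) - w (grid t n k)).

Lemma within_cvg (A : set R) (x : R -> R) p e :
  {within A, continuous x} -> A p -> 0 < e ->
  exists2 r : R, 0 < r & forall s, A s -> `|s - p| < r -> `|x s - x p| < e.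
Proof.
move=> /subspace_continuousP cx Ap e0.
have /cvgrPdist_lt /(_ e e0) := cx p Ap.
rewrite /within /= => /nbhs_ballP[r /= r0 H]; exists r => // s As sp.
by rewrite distrC; apply: H => //; rewrite /ball/= distrC.
Qed.

Lemma uniform_continuity_segment (x : R -> R) (t e : R) :
  0 <= t -> {within `[0, t], continuous x} -> 0 < e ->
  exists2 dl : R, 0 < dl & forall s s', 0 <= s <= t -> 0 <= s' <= t ->
    `|s - s'| < dl -> `|x s - x s'| < e.
Proof.
move=> t0 cx e0.
(* Only [s] is confined to [[a, b]], while [s'] ranges over [[0, t]]; this asymmetry makes [Q]
   transitive. *)
pose Q a b := exists2 dl : R, 0 < dl & forall s s', a <= s <= b ->
  0 <= s <= t -> 0 <= s' <= t -> `|s - s'| < dl -> `|x s - x s'| < e.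
have [||dl dl0 H] := @cousin R 0 t Q t0.
- move=> a b c [d1 d10 H1] [d2 d20 H2]; exists (Num.min d1 d2).
    by rewrite lt_min d10.
  move=> s s' /andP[as_ sc] st s't; rewrite lt_min => /andP[ss1 ss2].
  have [sb|bs] := leP s b; first by apply: H1 => //; rewrite as_.
  by apply: H2 => //; rewrite (ltW bs).
- move=> p pt; have e20 : 0 < e / 2 by rewrite divr_gt0.
  have [|r r0 H] := within_cvg (p := p) cx _ e20; first by rewrite /= in_itv.
  have r20 : 0 < r / 2 by rewrite divr_gt0.
  exists (r / 2) => // a b pa /andP[ap pb] bp a0 bt.
  exists (r / 2) => // s s' /andP[as_ sb] st s't ss'.
  have sp : `|s - p| < r / 2 by rewrite ltr_distl; apply/andP; split; lra.
  have -> : x s - x s' = (x s - x p) - (x s' - x p) by ring.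
  apply: (le_lt_trans (ler_normB _ _)); rewrite [e]splitr; apply: ltrD.
    by apply: H; rewrite /= ?in_itv//; apply: (lt_trans sp); lra.
  apply: H; first by rewrite /= in_itv.
  have -> : s' - p = (s - p) - (s - s') by ring.
  by apply: (le_lt_trans (ler_normB _ _)); rewrite [r]splitr; apply: ltrD.
- by exists dl => // s s' st; apply: H.
Qed.

Lemma bounded_segment (x : R -> R) (t : R) :
  0 <= t -> {within `[0, t], continuous x} ->
  exists2 M : R, 0 <= M & forall s, 0 <= s <= t -> `|x s| <= M.
Proof.
move=> t0 cx.
pose Q a b := exists2 M : R, 0 <= M & forall s, a <= s <= b ->
  0 <= s <= t -> `|x s| <= M.
have [||M M0 H] := @cousin R 0 t Q t0.
- move=> a b c [M1 M10 H1] [M2 M20 H2]; exists (Num.max M1 M2).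
    by rewrite le_max M10.
  move=> s /andP[as_ sc] st; rewrite le_max; apply/orP.
  have [sb|bs] := leP s b; first by left; apply: H1; rewrite ?as_.
  by right; apply: H2; rewrite ?(ltW bs).
- move=> p pt.
  have [|r r0 H] := within_cvg (p := p) cx _ (@ltr01 R); first by rewrite /= in_itv.
  exists r => // a b pa /andP[ap pb] bp a0 bt.
  exists (`|x p| + 1); first by rewrite addr_ge0.
  move=> s /andP[as_ sb] st.
  have sp : `|s - p| < r by rewrite ltr_distl; apply/andP; split; lra.
  have -> : x s = x p + (x s - x p) by ring.
  apply: (le_trans (ler_normD _ _)); rewrite lerD2l ltW//.
  by apply: H => //; rewrite /= in_itv.
- by exists M => // s st; apply: H.
Qed.

Lemma expR_sub1_le (h : R) : expR h - 1 <= h * expR h.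
Proof.
have := expR_ge1Dx (- h); rewrite expRN => H.
have E0 := expR_gt0 h.
have : (1 - h) * expR h <= 1.
  by rewrite -ler_pdivlMr// div1r.
by lra.
Qed.

(** Put [h = t / n], [y_k = x(t_k)], and let [J_k] be the integral of [- x] over the [k]-th step.
    The error telescopes into the terms [- e^(-(t - t_k)) (J_k + h y_(k+1) + (e^h - 1 - h)
    y_(k+1))]: the modulus of continuity bounds [J_k + h y_(k+1)] by [h e], and
    [e^h - 1 - h <= h (e^h - 1)] bounds the rest. No regularity of [w] enters. *)
Lemma exp_scheme_error (t e M : R) (n : nat) (x w : R -> R) :
  0 <= t -> (0 < n)%N -> {within `[0, t], continuous x} ->
  (forall s, 0 <= s <= t -> `|x s| <= M) ->
  (forall s s', 0 <= s <= t -> 0 <= s' <= t -> `|s - s'| <= t / n%:R ->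
    `|x s - x s'| <= e) ->
  (forall k, (k <= n)%N -> x (grid t n k) = x 0 +
    (\int[mu]_(s in `[0, grid t n k]) (- x s))%R +
    (w (grid t n k) - w 0)) ->
  `|exp_scheme t n (x 0) w - x t| <= t * (e + (expR (t / n%:R) - 1) * M).
Proof.
move=> t0 n0 cx xM xe xeq.
pose h := t / n%:R; pose y k := x (grid t n k).
have h0 : 0 <= h by rewrite divr_ge0.
have gt k : (k <= n)%N -> grid t n k <= t.
  by move=> kn; rewrite -[leRHS](gridn t n0) grid_le.
have M0 : 0 <= M by apply: le_trans (xM 0 _); rewrite ?lexx.
have int s : s <= t -> mu.-integrable `[0, s] (EFin \o (fun s => - x s)).
  move=> st; apply: continuous_compact_integrable; first exact: segment_compact.
  have cN : {within `[0, t], continuous (fun s => - x s)}.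
    by move=> s'; apply: cvgN; exact: cx.
  by apply: continuous_subspaceW cN; apply: subset_itvl; rewrite bnd_simp.
pose J k := (\int[mu]_(s in `]grid t n k, grid t n k.+1]) (- x s))%R.
have Jle k : (k < n)%N -> `|J k + h * y k.+1| <= h * e.
  move=> kn; set a := grid t n k; set b := grid t n k.+1.
  have a0 : 0 <= a by exact: grid_ge0.
  have ab : a <= b by exact: grid_le.
  have bt : b <= t by exact: gt.
  have mI : measurable (`]a, b] : set (measurableTypeR R)) by exact: measurable_itv.
  have int' : mu.-integrable `]a, b] (EFin \o (fun s => - x s)).
    apply: integrableS (int _ bt) => //.
    by apply: subset_itvr; rewrite bnd_simp.
  have intc (c : R) : mu.-integrable `]a, b] (EFin \o (fun=> c)).
    apply: (@integrableS _ _ _ mu `[a, b]%classic) => //.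
      by apply: subset_itvr; rewrite bnd_simp.
    apply: continuous_compact_integrable; first exact: segment_compact.
    by apply: continuous_subspaceT => s; exact: cvg_cst.
  have mub : fine (mu `]a, b]%classic) = h.
    rewrite lebesgue_measure_itv/= lte_fin; case: ltP => [_|ba].
      by rewrite /b gridS -/a /h/= addrC addKr.
    by move=> /=; have := gridS t n k; rewrite -/a -/b -/h => bE; lra.
  have -> : h * y k.+1 = (\int[mu]_(s in `]a, b]) (y k.+1))%R.
    by rewrite Rintegral_cst// mub mulrC.
  rewrite -RintegralD//.
  apply: (le_trans (le_normr_Rintegral _ _)) => //.
    have := integrableD mI int' (intc (y k.+1)); exact: eq_integrable.
  have -> : h * e = (\int[mu]_(s in `]a, b]) e)%R.
    by rewrite Rintegral_cst// mub mulrC.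
  apply: le_Rintegral => //.
    have := integrable_abse (integrableD mI int' (intc (y k.+1))).
    exact: eq_integrable.
  move=> s; rewrite /= in_itv/= => /andP[as_ sb].
  rewrite addrC /y -/b; apply: xe.
  - by rewrite bt (le_trans a0 ab).
  - by rewrite (le_trans a0 (ltW as_)) (le_trans sb bt).
  - have := gridS t n k; rewrite -/a -/b -/h => bE.
    by rewrite -/h ger0_norm ?subr_ge0// lerBlDr bE addrC lerD2l ltW.
have ystep k : (k < n)%N ->
    w (grid t n k.+1) - w (grid t n k) = y k.+1 - y k - J k.
  move=> kn; have xk := xeq _ (ltnW kn); have xk1 := xeq _ kn.
  have := @Rintegral_itvB _ (fun s => - x s) (BLeft 0) (BRight (grid t n k.+1))
    (grid t n k) (int _ (gt _ kn)).
  rewrite !bnd_simp => /(_ (grid_ge0 _ _ t0) (grid_le _ t0 (leqnSn k))).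
  rewrite -/(J k) => Jk; rewrite /y; lra.
pose a k := expR (- (t - grid t n k)) * y k.
have aE : expR (- t) * x 0 = a 0%N by rewrite /a /y grid0 subr0.
have an : x t = a n by rewrite /a /y gridn// subrr oppr0 expR0 mul1r.
rewrite /exp_scheme aE an addrAC.
rewrite (_ : a 0%N - a n = \sum_(k < n) - (a k.+1 - a k)); last first.
  rewrite sumrN -(big_mkord xpredT (fun k => a k.+1 - a k)).
  by rewrite telescope_sumr// opprB.
rewrite -big_split/=.
have tE : t * (e + (expR (t / n%:R) - 1) * M) =
    \sum_(k < n) (h * e + h * (expR h - 1) * M).
  have hn : t = h * n%:R by rewrite /h divfK// pnatr_eq0 -lt0n.
  by rewrite -/h sumr_const card_ord -[RHS]mulr_natr {1}hn; ring.
rewrite tE; apply: (le_trans (ler_norm_sum _ _ _)); apply: ler_sum => k _.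
rewrite ystep//.
have -> : a k.+1 = expR h * expR (- (t - grid t n k)) * y k.+1.
  by rewrite /a gridS -/h -expRD; congr (expR _ * _); ring.
have -> : - (expR h * expR (- (t - grid t n k)) * y k.+1 - a k) +
    expR (- (t - grid t n k)) * (y k.+1 - y k - J k) =
    - expR (- (t - grid t n k)) * ((J k + h * y k.+1) +
      (expR h - 1 - h) * y k.+1) by rewrite /a; ring.
rewrite normrM normrN (ger0_norm (expR_ge0 _)).
have kt : grid t n k <= t by exact/gt/ltnW.
have y1 : `|y k.+1| <= M by apply: xM; rewrite gt// grid_ge0.
have e1 : 0 <= expR h - 1 - h by have := expR_ge1Dx h; lra.
have e2 : expR h - 1 - h <= h * (expR h - 1).
  by have := expR_sub1_le h; lra.
apply: (@le_trans _ _ (1 * `|(J k + h * y k.+1) + (expR h - 1 - h) * y k.+1|)).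
  apply: ler_wpM2r => //.
  by rewrite -expR0 ler_expR oppr_le0 subr_ge0.
rewrite mul1r; apply: (le_trans (ler_normD _ _)); apply: lerD; first exact: Jle.
rewrite normrM (ger0_norm e1).
by apply: ler_pM.
Qed.

Lemma exp_scheme_cvg (t : R) (x w : R -> R) :
  0 <= t -> {within `[0, +oo[, continuous x} ->
  (forall n k, x (grid t n k) = x 0 +
    (\int[mu]_(s in `[0, grid t n k]) (- x s))%R +
    (w (grid t n k) - w 0)) ->
  exp_scheme t n (x 0) w @[n --> \oo] --> x t.
Proof.
move=> t0 cx xeq.
have {}cx : {within `[0, t], continuous x}.
  by apply: continuous_subspaceW cx; apply: subset_itvl; rewrite bnd_simp.
have [M M0 xM] := bounded_segment t0 cx.
apply/cvgrPdist_le => e e0.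
(* Multiplied by [t] this is at most [e / 2]; the [+ 1] covers [t = 0]. *)
have e1 : 0 < e / (2 * (t + 1)) by rewrite divr_gt0// mulr_gt0//; lra.
have [dl dl0 xe] := uniform_continuity_segment t0 cx e1.
have hn : t / n%:R @[n --> \oo] --> (0 : R).
  rewrite -[X in _ --> X](mulr0 t); apply: cvgMr.
  rewrite -cvg_shiftS; exact: cvg_harmonic.
have Hn : t * ((expR (t / n%:R) - 1) * M) @[n --> \oo] --> (0 : R).
  rewrite -[X in _ --> X](mulr0 t); apply: cvgMr.
  rewrite -[X in _ --> X](mul0r M); apply: cvgMl.
  rewrite -[X in _ --> X](subrr (1 : R)); apply: cvgB; last exact: cvg_cst.
  rewrite -[X in _ --> X]expR0; apply: (cvg_comp _ expR hn); exact: continuous_expR.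
have e2 : 0 < e / 2 by rewrite divr_gt0.
have /cvgrPdist_lt /(_ _ dl0) hn' := hn.
have /cvgrPdist_le /(_ _ e2) Hn' := Hn.
near=> n.
rewrite distrC; apply: (le_trans (exp_scheme_error (e := e / (2 * (t + 1)))
  (M := M) _ _ cx _ _ _)) => //.
- by near: n; exact: nbhs_infty_gt.
- move=> s s' st s't ss'; apply/ltW/xe => //.
  apply: (le_lt_trans ss').
  apply: le_lt_trans (ler_norm _) _; rewrite -[t / _]subr0 distrC.
  by near: n; exact: hn'.
- rewrite mulrDr [e in leRHS]splitr lerD//.
    rewrite mulrA ler_pdivrMr; last by lra.
    by nra.
  apply: (le_trans (ler_norm _)); rewrite -[t * _]subr0 distrC.
  by near: n; exact: Hn'.
Unshelve. all: by end_near. Qed.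

End exponential_scheme.

(** * Second moment of the limit of the exponential Euler sums *)

Lemma second_moment_fatou d (T : measurableType d) (R : realType)
    (P : probability T R) (X_ : nat -> T -> R) (X : T -> R) (r : R) :
  (forall k, measurable_fun setT (X_ k)) -> measurable_fun setT X ->
  {ae P, forall w, X_ k w @[k --> \oo] --> X w} ->
  (forall k, \int[P]_w ((X_ k w) ^+ 2)%:E <= r%:E)%E ->
  (\int[P]_w ((X w) ^+ 2)%:E <= r%:E)%E.
Proof.
move=> mX_ mX [N [mN PN0 subN]] Xr.
have mE (Z : T -> R) (A : set T) : measurable_fun setT Z ->
    measurable_fun A (fun w => ((Z w) ^+ 2)%:E).
  by move=> mZ; apply: measurable_funTS; apply/measurable_EFinP; exact: measurable_funX.
have pE (A : set T) (Z : T -> R) w : A w -> (0 <= ((Z w) ^+ 2)%:E)%E.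
  by move=> _; rewrite lee_fin sqr_ge0.
have mD : measurable (setT `\` N) by exact: measurableD.
rewrite (ge0_negligible_integral mN)//; [|exact: mE|exact: pE].
have -> : (\int[P]_(w in setT `\` N) ((X w) ^+ 2)%:E =
    \int[P]_(w in setT `\` N) limn_einf (fun k => ((X_ k w) ^+ 2)%:E))%E.
  apply: eq_integral => w; rewrite inE/= => -[_ Nw].
  have cw : X_ k w @[k --> \oo] --> X w.
    by apply: contrapT => h; apply: Nw; exact: subN.
  have cw2 : (((X_ k w) ^+ 2)%:E @[k --> \oo] --> ((X w) ^+ 2)%:E)%E.
    apply: cvg_EFin; first exact: nearW.
    by apply: (cvg_comp _ (fun u => u ^+ 2) cw); exact: exprn_continuous.
  rewrite is_cvg_limn_einfE; last by apply/cvg_ex; eexists; exact: cw2.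
  by apply/esym/cvg_lim.
apply: (le_trans (fatou P mD (fun k => mE _ _ (mX_ k)) _)).
  by move=> k w Dw; exact: pE Dw.
rewrite limn_einf_lim; apply: lime_le; first exact: is_cvg_einfs.
apply: nearW => k; apply: (@le_trans _ _ (\int[P]_(w in setT `\` N) ((X_ k w) ^+ 2)%:E)%E).
  by apply: ereal_inf_lbound; exists k => /=.
apply: le_trans (Xr k).
apply: ge0_subset_integral => //; first exact: mE.
by move=> w _; exact: (pE setT).
Qed.

Section exponential_weights.
Context {R : realType} (t : R).
Hypothesis t0 : 0 <= t.

Definition exp_weight (n k : nat) : R := expR (- (t - grid t n k)).

(** The left Riemann sum of [e^(-2(t - s))] over [[0, t]]. *)
Definition exp_weight_sqr_sum (n : nat) : R :=
  \sum_(k < n) (grid t n k.+1 - grid t n k) * exp_weight n k ^+ 2.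

(** The fine grid point [k] lies in the coarse cell [k %/ p], of length [t / n], and [e^(-(t - s))]
    is 1-Lipschitz for [s <= t]. *)
Lemma exp_weight_lip n p k : (0 < n)%N -> (0 < p)%N -> (k < n * p)%N ->
  (exp_weight (n * p) k - exp_weight n (k %/ p)) ^+ 2 <= (t / n%:R) ^+ 2.
Proof.
move=> n0 p0 knp.
have np0 : (0 < n * p)%N by rewrite muln_gt0 n0.
have gk : grid t n (k %/ p) = grid t (n * p) (k %/ p * p).
  rewrite /grid !natrM; field.
  by rewrite !pnatr_eq0 -!lt0n n0 p0.
have g1 : grid t n (k %/ p) <= grid t (n * p) k.
  by rewrite gk grid_le// leq_trunc_div.
have g2 : grid t (n * p) k <= grid t n (k %/ p) + t / n%:R.
  have -> : grid t n (k %/ p) + t / n%:R = grid t (n * p) ((k %/ p).+1 * p).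
    rewrite gk /grid !natrM -natr1; field.
    by rewrite !pnatr_eq0 -!lt0n n0 p0.
  by rewrite grid_le// ltnW// ltn_ceil.
have g3 : grid t (n * p) k <= t.
  by rewrite -[leRHS](gridn t np0) grid_le// ltnW.
rewrite /exp_weight; set a := grid t (n * p) k in g1 g2 g3 *.
set b := grid t n _ in g1 g2 *.
have h1 : expR (- (t - b)) <= expR (- (t - a)) by rewrite ler_expR; lra.
have h2 : expR (- (t - a)) - expR (- (t - b)) <= t / n%:R.
  have -> : expR (- (t - b)) = expR (- (t - a)) * expR (- (a - b)).
    by rewrite -expRD; congr expR; ring.
  have h3 : expR (- (t - a)) <= 1 by rewrite -expR0 ler_expR; lra.
  have h4 := expR_ge0 (- (t - a)).
  have h5 := expR_ge1Dx (- (a - b)).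
  have h6 : expR (- (a - b)) <= 1 by rewrite -expR0 ler_expR; lra.
  by nra.
by rewrite ler_sqr ?nnegrE ?subr_ge0// divr_ge0.
Qed.

(** The squared weights form a geometric sequence of ratio [e^(2h)], so [e^(2h) - 1] times their sum
    telescopes to [1 - e^(-2t)]; then [2h <= e^(2h) - 1 <= 2h e^(2h)]. *)
Lemma exp_weight_sqr_sum_bounds n : (0 < n)%N ->
  expR (- (2 * (t / n%:R))) * ((1 - expR (- (2 * t))) / 2) <= exp_weight_sqr_sum n
  <= (1 - expR (- (2 * t))) / 2.
Proof.
move=> n0; set h := t / n%:R.
have h0 : 0 <= h by rewrite divr_ge0.
pose a k := exp_weight n k ^+ 2.
have aE k : a k = expR (- (2 * (t - grid t n k))).
  by rewrite /a /exp_weight -expRM_natl; congr expR; ring.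
have aS k : a k.+1 - a k = (expR (2 * h) - 1) * a k.
  rewrite !aE gridS -/h.
  have -> : - (2 * (t - (grid t n k + h))) = 2 * h + - (2 * (t - grid t n k)).
    by ring.
  by rewrite expRD; ring.
have tel : 1 - expR (- (2 * t)) = (expR (2 * h) - 1) * \sum_(k < n) a k.
  rewrite mulr_sumr (eq_bigr (fun k : 'I_n => a k.+1 - a k)); last first.
    by move=> k _; rewrite aS.
  rewrite -(big_mkord xpredT (fun k => a k.+1 - a k)) telescope_sumr//.
  by rewrite !aE grid0 gridn// subrr subr0 mulr0 oppr0 expR0.
have qE : exp_weight_sqr_sum n = h * \sum_(k < n) a k.
  rewrite /exp_weight_sqr_sum mulr_sumr; apply: eq_bigr => k _.
  by rewrite gridS addrC addKr.
have s0 : 0 <= \sum_(k < n) a k by apply: sumr_ge0 => k _; exact: sqr_ge0.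
rewrite qE tel; set s := \sum_(k < n) _ in s0 *.
have e1 := expR_ge1Dx (2 * h).
have e2 := expR_sub1_le (2 * h).
have E0 := expR_gt0 (2 * h).
apply/andP; split; last by nra.
rewrite expRN mulrC ler_pdivrMr//.
by nra.
Qed.

Lemma cvg_exp_weight_sqr_sum :
  exp_weight_sqr_sum n @[n --> \oo] --> (1 - expR (- (2 * t))) / 2.
Proof.
set q := (_ / 2).
have hn : t / n%:R @[n --> \oo] --> (0 : R).
  rewrite -[X in _ --> X](mulr0 t); apply: cvgMr.
  rewrite -cvg_shiftS; exact: cvg_harmonic.
apply: (@squeeze_cvgr _ _ _ _ (fun n => expR (- (2 * (t / n%:R))) * q) (cst q)).
- near=> n; apply: exp_weight_sqr_sum_bounds.
  by near: n; exact: nbhs_infty_gt.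
- rewrite -[X in _ --> X](mul1r q); apply: cvgMl.
  have h2n : - (2 * (t / n%:R)) @[n --> \oo] --> (0 : R).
    rewrite -[X in _ --> X]oppr0; apply: cvgN.
    by rewrite -[X in _ --> X](mulr0 2); exact: cvgMr.
  rewrite -[X in _ --> X]expR0; apply: (cvg_comp _ expR h2n).
  exact: continuous_expR.
- exact: cvg_cst.
Unshelve. all: by end_near. Qed.

(** Splitting the coarse increments expresses both schemes through the same fine increments, so that
    the isometry applies to their difference. *)
Lemma exp_scheme_refine n p x0 (w : R -> R) : (0 < n)%N -> (0 < p)%N ->
  exp_scheme t n x0 w = expR (- t) * x0 + \sum_(k < n * p)
    exp_weight n (k %/ p) * (w (grid t (n * p) k.+1) - w (grid t (n * p) k)).
Proof.
move=> n0 p0; congr (_ + _).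
rewrite -[RHS](big_mkord xpredT (fun k => exp_weight n (k %/ p) *
  (w (grid t (n * p) k.+1) - w (grid t (n * p) k)))).
rewrite big_nat_mul big_mkord; apply: eq_bigr => j _.
have gk i : grid t n i = grid t (n * p) (i * p).
  rewrite /grid !natrM; field.
  by rewrite !pnatr_eq0 -!lt0n n0 p0.
rewrite -/(exp_weight n j) !gk.
rewrite -(@telescope_sumr _ _ _ (fun k => w (grid t (n * p) k))); last first.
  by rewrite leq_mul2r leqnSn orbT.
rewrite mulr_sumr; apply: eq_big_nat => i /andP[i1 i2].
congr (exp_weight n _ * _); apply/eqP; rewrite eqn_leq.
by rewrite leq_divRL// i1 -ltnS ltn_divLR// i2.
Qed.

End exponential_weights.

Section limit_second_moment.
Context d (T : measurableType d) (R : realType) (P : probability T R)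
  (F : R -> set (set T)) (m : nat) (W : R -> T -> 'cV[R]_m).
Hypotheses (hF : is_filtration F) (hW : is_brownian P F W).
Context (t : R) (t0 : 0 <= t) (i : 'I_m) (X0 Z : T -> R) (v : R).
Hypotheses (mX0 : measurable_wrt (F 0) X0) (mZ : measurable_fun setT Z)
  (X0v : (\int[P]_w ((X0 w) ^+ 2)%:E = v%:E)%E).

Let V n w := exp_scheme t n (X0 w) (fun s => W s w i ord0).

Hypothesis VZ : {ae P, forall w, V n w @[n --> \oo] --> Z w}.

Let grid_monoS n k : (k < n)%N -> grid t n k <= grid t n k.+1.
Proof. by move=> _; exact: grid_le. Qed.

Let grid00 n : 0 <= grid t n 0.
Proof. by rewrite grid0. Qed.

Let measurable_wrt_cst s (c : R) : 0 <= s -> measurable_wrt (F s) (cst c : T -> R).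
Proof.
by move=> s0; apply/(measurable_wrtP (filtration_sigma hF s0)); exact: measurable_cst.
Qed.

Let mV0 (c : R) : measurable_wrt (F 0) (fun w => c * X0 w).
Proof.
have sF := filtration_sigma hF (lexx 0).
move: mX0 => /(measurable_wrtP sF) mX.
by apply/(measurable_wrtP sF); exact: measurable_funM.
Qed.

Let integral_sqr_cst (c : R) : (\int[P]_w ((cst c w) ^+ 2)%:E = (c ^+ 2)%:E)%E.
Proof.
rewrite (eq_integral (cst (c ^+ 2)%:E))//.
by rewrite integral_cst// [X in (_ * X)%E]probability_setT mule1.
Qed.

Let VE n w : V n w = ito_sum W (grid t n) i (fun w => expR (- t) * X0 w)
  (fun k => cst (exp_weight t n k)) n w.
Proof.
rewrite /V /exp_scheme /ito_sum; congr (_ + _); apply: eq_bigr => k _.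
by rewrite /= /increment !mxE.
Qed.

Lemma measurable_exp_scheme n : measurable_fun setT (V n).
Proof.
have gn0 : 0 <= grid t n n by exact: grid_ge0.
apply: (measurable_wrt_measurable (filtration_sub hF gn0)).
have -> : V n = ito_sum W (grid t n) i (fun w => expR (- t) * X0 w)
  (fun k => cst (exp_weight t n k)) n by apply/funext => w; exact: VE.
apply: (measurable_ito_sum (n := n) hF hW (grid00 n) (@grid_monoS n)) => //.
- by rewrite grid0.
- by move=> j _; apply: measurable_wrt_cst; exact: grid_ge0.
Qed.

Lemma exp_scheme_second_moment n :
  (\int[P]_w ((V n w) ^+ 2)%:E =
   (expR (- (2 * t)) * v + exp_weight_sqr_sum t n)%:E)%E.
Proof.
under eq_integral do rewrite VE.
rewrite (ito_sum_isometry hF hW (grid00 n) (@grid_monoS n)); last 2 first.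
- by rewrite grid0.
- by move=> j _; apply: measurable_wrt_cst; exact: grid_ge0.
rewrite EFinD; congr (_ + _)%E.
  under eq_integral do rewrite exprMn EFinM.
  rewrite ge0_integralZl_EFin//.
  - by rewrite X0v -EFinM -expRM_natl; congr ((expR _ * _)%:E); ring.
  - by move=> w _; rewrite lee_fin sqr_ge0.
  - apply/measurable_EFinP; apply: measurable_funX.
    exact: measurable_wrt_measurable (filtration_sub hF (lexx 0)) mX0.
rewrite /exp_weight_sqr_sum -sumEFin; apply: eq_bigr => k _.
by rewrite integral_sqr_cst -EFinM.
Qed.

Lemma exp_scheme_refine_error n p : (0 < n)%N -> (0 < p)%N ->
  (\int[P]_w ((V (n * p) w - V n w) ^+ 2)%:E <= (t * (t / n%:R) ^+ 2)%:E)%E.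
Proof.
move=> n0 p0.
have np0 : (0 < n * p)%N by rewrite muln_gt0 n0.
pose c k := exp_weight t (n * p) k - exp_weight t n (k %/ p).
rewrite (eq_integral (fun w => (ito_sum W (grid t (n * p)) i (cst 0)
    (fun k => cst (c k)) (n * p) w ^+ 2)%:E)); last first.
  move=> w _; congr ((_ ^+ 2)%:E).
  rewrite /V (exp_scheme_refine t _ _ n0 p0) /exp_scheme /ito_sum/=.
  rewrite opprD addrACA subrr !add0r -sumrB; apply: eq_bigr => k _.
  by rewrite /increment !mxE /c mulrBl.
rewrite (ito_sum_isometry hF hW (grid00 _) (@grid_monoS _)); last 2 first.
- by rewrite grid0; exact: measurable_wrt_cst.
- by move=> j _; apply: measurable_wrt_cst; exact: grid_ge0.
rewrite [X in (X + _)%E]integral0_eq ?add0e; last first.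
  by move=> w _ /=; rewrite expr0n.
have -> : (t * (t / n%:R) ^+ 2)%:E =
    (\sum_(j < n * p) (grid t (n * p) j.+1 - grid t (n * p) j)%:E *
       ((t / n%:R) ^+ 2)%:E)%E.
  rewrite -ge0_sume_distrl; last first.
    by move=> j _; rewrite lee_fin subr_ge0 grid_monoS.
  rewrite EFinM; congr (_ * _)%E; rewrite sumEFin; congr EFin.
  rewrite -(big_mkord xpredT (fun j => grid t (n * p) j.+1 - grid t (n * p) j)).
  by rewrite telescope_sumr// gridn// grid0 subr0.
apply: lee_sum => k _; apply: lee_wpmul2l.
  by rewrite lee_fin subr_ge0 grid_monoS.
rewrite integral_sqr_cst lee_fin.
exact: (exp_weight_lip t0 n0 p0 (ltn_ord k)).
Qed.

(** The bound for refinements is uniform in [p], and Fatou's lemma carries it to the almost sure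
    limit. *)
Lemma exp_scheme_error_second_moment n : (0 < n)%N ->
  (\int[P]_w ((Z w - V n w) ^+ 2)%:E <= (t * (t / n%:R) ^+ 2)%:E)%E.
Proof.
move=> n0.
apply: (second_moment_fatou (X_ := fun p w => V (n * p.+1) w - V n w)).
- by move=> p; apply: measurable_funB; exact: measurable_exp_scheme.
- by apply: measurable_funB => //; exact: measurable_exp_scheme.
- apply: filterS VZ => w VZw.
  apply: cvgB; last exact: cvg_cst.
  apply: (@cvg_comp _ _ _ (fun p => n * p.+1)%N (V ^~ w) \oo \oo) => //.
  apply/cvgnyPge => A; near=> p.
  have : (A <= p)%N by near: p; exact: nbhs_infty_ge.
  by move=> Ap; rewrite (leq_trans Ap)// (leq_trans (leqnSn p))// leq_pmull.
- by move=> p; exact: exp_scheme_refine_error.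
Unshelve. all: by end_near. Qed.

(** The second moments of [Z] and of the sums bound each other through [second_momentD_le], applied
    in both directions with a vanishing parameter. *)
Lemma limit_second_moment :
  (\int[P]_w ((Z w) ^+ 2)%:E =
   (expR (- (2 * t)) * v + (1 - expR (- (2 * t))) / 2)%:E)%E.
Proof.
pose c n := expR (- (2 * t)) * v + exp_weight_sqr_sum t n.+1.
set cl := _ + _.
have c_cl : c n @[n --> \oo] --> cl.
  apply: cvgD; first exact: cvg_cst.
  by rewrite (cvg_shiftS (exp_weight_sqr_sum t)); exact: cvg_exp_weight_sqr_sum.
(* The squared L2 error is of order [1 / n^2], so dividing it by [e n] still leaves the remainder
   [r n] tending to 0. *)
pose e n : R := n.+1%:R^-1.
have e0 n : 0 < e n by rewrite invr_gt0.
have e_0 : e n @[n --> \oo] --> (0 : R) by exact: cvg_harmonic.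
pose r n := (1 + (e n)^-1) * (t * (t / n.+1%:R) ^+ 2).
have r_0 : r n @[n --> \oo] --> (0 : R).
  rewrite (_ : r = (fun n => t ^+ 3 * (e n ^+ 2 + e n))); last first.
    apply/funext => n; rewrite /r /e invrK; field.
    by rewrite addr_eq0 gt_eqF// (@lt_le_trans _ _ 0)// oppr_lt0.
  rewrite -[X in _ --> X](mulr0 (t ^+ 3)); apply: cvgMr.
  rewrite -[X in _ --> X](addr0 0); apply: cvgD => //.
  rewrite -[X in _ --> X](mul0r 0).
  by under eq_fun do rewrite expr2; exact: cvgM.
have mVn n : measurable_fun setT (V n) by exact: measurable_exp_scheme.
have mZV n : measurable_fun setT (fun w => Z w - V n w) by exact: measurable_funB.
have mVZ n : measurable_fun setT (fun w => V n w - Z w) by exact: measurable_funB.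
have up n : (\int[P]_w ((Z w) ^+ 2)%:E <= ((1 + e n) * c n + r n)%:E)%E.
  rewrite (eq_integral (fun w => ((V n.+1 w + (Z w - V n.+1 w)) ^+ 2)%:E)); last first.
    by move=> w _; congr ((_ ^+ 2)%:E); ring.
  apply: (le_trans (second_momentD_le P (e0 n) (mVn _) (mZV _))).
  rewrite exp_scheme_second_moment [leRHS]EFinD; apply: leeD.
    by rewrite [leRHS]EFinM.
  rewrite /r [leRHS]EFinM lee_wpmul2l//.
    by rewrite lee_fin addr_ge0// invr_ge0 ltW.
  exact: exp_scheme_error_second_moment.
have fin : (\int[P]_w ((Z w) ^+ 2)%:E)%E \is a fin_num.
  rewrite ge0_fin_numE; last by apply: integral_ge0 => w _; rewrite lee_fin sqr_ge0.
  by apply: le_lt_trans (up 0%N) _; exact: ltry.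
pose z := fine (\int[P]_w ((Z w) ^+ 2)%:E)%E.
have zE : (\int[P]_w ((Z w) ^+ 2)%:E = z%:E)%E by rewrite /z fineK.
have up' n : z <= (1 + e n) * c n + r n by rewrite -lee_fin -zE.
have dn n : c n <= (1 + e n) * z + r n.
  rewrite -lee_fin -exp_scheme_second_moment.
  rewrite (eq_integral (fun w => ((Z w + (V n.+1 w - Z w)) ^+ 2)%:E)); last first.
    by move=> w _; congr ((_ ^+ 2)%:E); ring.
  apply: (le_trans (second_momentD_le P (e0 n) mZ (mVZ _))).
  rewrite zE [leRHS]EFinD; apply: leeD; first by rewrite [leRHS]EFinM.
  rewrite /r [leRHS]EFinM lee_wpmul2l//.
    by rewrite lee_fin addr_ge0// invr_ge0 ltW.
  under eq_integral do rewrite -sqrrN opprB.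
  exact: exp_scheme_error_second_moment.
rewrite zE; congr EFin; apply/le_anti/andP; split.
- have lim : (1 + e n) * c n + r n @[n --> \oo] --> (1 + 0) * cl + 0.
    by apply: cvgD => //; apply: cvgM => //; apply: cvgD => //; exact: cvg_cst.
  rewrite !addr0 mul1r in lim.
  rewrite -(cvg_lim _ lim)//; apply: limr_ge; last exact: nearW.
  by apply/cvg_ex; eexists; exact: lim.
- have lim : (1 + e n) * z + r n @[n --> \oo] --> (1 + 0) * z + 0.
    by apply: cvgD => //; apply: cvgM; [apply: cvgD => //|]; exact: cvg_cst.
  rewrite !addr0 mul1r in lim.
  by apply: ler_cvg_to c_cl lim _; exact: nearW.
Qed.

End limit_second_moment.

(** * The Wasserstein distance to a coordinate projection *)

Section wasserstein_facts.
Context {R : realType} (n : nat).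
Local Notation E := 'cV[R]_n.

Lemma sqnorm_ge0 (x : E) : 0 <= sqnorm x.
Proof. by apply: sumr_ge0 => i _; exact: sqr_ge0. Qed.

Lemma sqnormN (x : E) : sqnorm (- x) = sqnorm x.
Proof. by apply: eq_bigr => i _; rewrite mxE sqrrN. Qed.

Lemma measurable_coordB d (T : measurableType d) (f g : T -> E) (i : 'I_n) :
  measurable_fun setT f -> measurable_fun setT g ->
  measurable_fun setT (fun w => ((f w i ord0 - g w i ord0) ^+ 2)%:E).
Proof.
move=> /measurable_fun_colvecP mf /measurable_fun_colvecP mg.
by apply/measurable_EFinP; apply: measurable_funX; exact: measurable_funB.
Qed.

Lemma sqnormBE (x y : E) :
  (sqnorm (x - y))%:E = (\sum_(i < n) ((x i ord0 - y i ord0) ^+ 2)%:E)%E.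
Proof. by rewrite sumEFin; congr EFin; apply: eq_bigr => i _; rewrite !mxE. Qed.

Lemma measurable_sqnormB :
  measurable_fun setT (fun z : E * E => (sqnorm (z.1 - z.2))%:E).
Proof.
under eq_fun do rewrite sqnormBE.
apply: emeasurable_sum => i.
by apply: measurable_coordB; [exact: measurable_fst|exact: measurable_snd].
Qed.

Lemma coupling_swap (mu nu : set E -> \bar R) (pi : probability (E * E)%type R) :
  coupling mu nu pi -> exists2 pi' : probability (E * E)%type R,
    coupling nu mu pi' & (\int[pi']_z (sqnorm (z.1 - z.2))%:E =
                          \int[pi]_z (sqnorm (z.1 - z.2))%:E)%E.
Proof.
move=> [pi1 pi2].
have ms : measurable_fun setT (fun z : E * E => (z.2, z.1)).
  by apply: measurable_fun_pair; [exact: measurable_snd|exact: measurable_fst].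
exists (law pi ms).
  by split=> A mA; [exact: pi2|exact: pi1].
rewrite (ge0_integral_distribution (mfun_of ms) measurable_sqnormB)/=.
  by apply: eq_integral => z _ /=; rewrite -sqnormN opprB.
by move=> z; rewrite lee_fin sqnorm_ge0.
Qed.

Lemma wasserstein2C (mu nu : set E -> \bar R) :
  wasserstein2 mu nu = wasserstein2 nu mu.
Proof.
rewrite /wasserstein2; congr (ereal_inf _ `^ _)%E; apply/seteqP.
by split=> _ [pi /coupling_swap[pi' cpi' <-] <-]; exists pi'.
Qed.

Lemma wasserstein2_sqr (mu nu : set E -> \bar R) :
  (wasserstein2 mu nu ^+ 2 = ereal_inf
    [set (\int[pi]_z (sqnorm (z.1 - z.2))%:E)%E | pi in coupling mu nu])%E.
Proof.
have h : (0 <= ereal_inf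
    [set (\int[pi]_z (sqnorm (z.1 - z.2))%:E)%E | pi in coupling mu nu])%E.
  apply: le_ereal_inf_tmp => _ [pi _ <-].
  by apply: integral_ge0 => z _; rewrite lee_fin sqnorm_ge0.
by rewrite /wasserstein2 poweR12_sqrt// sqr_sqrte.
Qed.

Lemma mul_pid_mx_coord r (x : E) i :
  ((pid_mx r : 'M[R]_n) *m x) i ord0 = if (i < r)%N then x i ord0 else 0.
Proof.
rewrite mxE (bigD1 i)//= big1 ?addr0 => [|j ji].
  by rewrite mxE eqxx/=; case: ifP => _; rewrite ?mul1r ?mul0r.
by rewrite mxE eq_sym (negbTE (_ : j != i :> nat)) ?mul0r.
Qed.

Context d (T : measurableType d) (P : probability T R).

Lemma wasserstein2_pid_mx r (X Z : T -> E) :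
  measurable_fun setT X -> measurable_fun setT Z ->
  same_law P Z (fun w => (pid_mx r : 'M[R]_n) *m X w) ->
  (wasserstein2 (pushforward P Z) (pushforward P X) ^+ 2 =
   \sum_(i < n | (r <= i)%N) \int[P]_w ((X w i ord0) ^+ 2)%:E)%E.
Proof.
move=> mX mZ ZX; rewrite wasserstein2_sqr.
set A : 'M[R]_n := pid_mx r.
have mAX : measurable_fun setT (fun w => A *m X w).
  exact: measurable_colvec_mulmx.
have mc i : measurable_fun setT (fun x : E => ((x i ord0) ^+ 2)%:E).
  by apply/measurable_EFinP; apply: measurable_funX; exact: measurable_colvec_coord.
have c0 i (x : E) : (0 <= ((x i ord0) ^+ 2)%:E)%E by rewrite lee_fin sqr_ge0.
apply/le_anti/andP; split.
- have mAXX : measurable_fun setT (fun w => (A *m X w, X w)).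
    exact: measurable_fun_pair.
  apply: ereal_inf_lbound; exists (law P mAXX).
    by split=> B mB //; rewrite /pushforward ZX.
  rewrite (ge0_integral_distribution (mfun_of mAXX) measurable_sqnormB)/=; last first.
    by move=> z; rewrite lee_fin sqnorm_ge0.
  rewrite big_mkcond/=.
  under eq_integral do rewrite /= sqnormBE.
  rewrite ge0_integral_sum//; last 2 first.
  + by move=> i; exact: measurable_coordB.
  + by move=> i w _; rewrite lee_fin sqr_ge0.
  apply: eq_bigr => i _; under eq_integral do rewrite mul_pid_mx_coord.
  case: (leqP r i) => ir /=.
    by apply: eq_integral => w _; rewrite sub0r sqrrN.
  by apply: integral0_eq => w _; rewrite subrr expr0n.
- apply: le_ereal_inf_tmp => _ [pi [pi1 pi2] <-].
  have mB i : measurable_fun setT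
      (fun z : E * E => ((z.1 i ord0 - z.2 i ord0) ^+ 2)%:E).
    by apply: measurable_coordB; [exact: measurable_fst|exact: measurable_snd].
  (* Only the coordinates from [r] on are kept. There [z.1] vanishes almost everywhere, so what
     remains depends on the second marginal alone, whatever the coupling. *)
  apply: (@le_trans _ _ (\int[pi]_z \sum_(i < n | (r <= i)%N)
      ((z.1 i ord0 - z.2 i ord0) ^+ 2)%:E)%E); last first.
    apply: ge0_le_integral => //.
    + by move=> z _; apply: sume_ge0 => i _; rewrite lee_fin sqr_ge0.
    + under eq_fun do rewrite big_mkcond/=.
      by apply: emeasurable_sum => i; case: (leqP r i).
    + exact: measurable_sqnormB.
    + move=> z _; rewrite sqnormBE [leRHS](bigID (fun i : 'I_n => (r <= i)%N))/=.
      by rewrite leeDl// sume_ge0// => i _; rewrite lee_fin sqr_ge0.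
  under [leRHS]eq_integral do rewrite big_mkcond/=.
  rewrite ge0_integral_sum//; last 2 first.
  + by move=> i; case: (leqP r i).
  + by move=> i z _; case: (leqP r i) => // _; rewrite lee_fin sqr_ge0.
  rewrite [leLHS]big_mkcond/=; apply: lee_sum => i _; case: leqP => ri //; last first.
    by apply: integral_ge0.
  rewrite le_eqVlt; apply/orP; left; apply/eqP.
  transitivity (\int[pi]_z ((z.2 i ord0) ^+ 2)%:E)%E.
    rewrite -[RHS](ge0_integral_distribution (P := pi) (mfun_of measurable_snd) (mc i) (c0 i)).
    rewrite -[LHS](ge0_integral_distribution (P := P) (mfun_of mX) (mc i) (c0 i)).
    by apply: eq_measure_integral => B mB' _; exact/esym/pi2.
  apply: ae_eq_integral => //.
    exact: (measurableT_comp (mc i) measurable_snd).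
  (* Null because its measure is read off the first marginal, where [Z] has the law of [A X]. *)
  exists (fst @^-1` [set x : E | x i ord0 != 0]).
  have m0 : measurable [set x : E | x i ord0 != 0].
    rewrite (_ : [set x | _] = setT `&` (fun x : E => x i ord0) @^-1` (~` [set 0])).
      by apply: measurable_colvec_coord => //; apply: measurableC.
    by rewrite setTI; apply/seteqP; split=> x /= /eqP.
  split.
  + by rewrite -[X in measurable X]setTI; exact: measurable_fst.
  + apply: (etrans (pi1 _ m0)); rewrite /pushforward ZX//.
    rewrite (_ : _ @^-1` _ = set0) ?measure0//; apply/seteqP; split=> w //=.
    by rewrite mul_pid_mx_coord ltnNge ri/= eqxx.
  + move=> z /= h; apply/negP => /eqP z0; apply: h => _.
    by rewrite z0 sub0r sqrrN.
Qed.

End wasserstein_facts.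

(** * Linear drift *)

Section second_moment_matrix.
Context d (T : measurableType d) (R : realType) (P : probability T R).

Lemma Rintegral_lincomb n (c : 'I_n -> R) (Z : 'I_n -> T -> R) :
  (forall k, P.-integrable setT (EFin \o Z k)) ->
  (\int[P]_w (\sum_k c k * Z k w) = \sum_k c k * \int[P]_w (Z k w))%R.
Proof.
move=> iZ; rewrite /Rintegral.
under eq_integral do rewrite -sumEFin.
have iZ' k : P.-integrable setT (fun w => (c k * Z k w)%:E).
  by have := integrableZl measurableT (c k) (iZ k); exact: eq_integrable.
rewrite integral_sum// -sum_fine; last first.
  by move=> k _; exact: integrable_fin_num.
apply: eq_bigr => k _.
under eq_integral do rewrite EFinM.
rewrite integralZl//; last exact: iZ.
by rewrite fineM//; exact: integrable_fin_num (iZ k).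
Qed.

Lemma expectation_mxE p q (M : T -> 'M[R]_(p, q)) i j :
  expectation_mx P M i j = (\int[P]_w (M w i j))%R.
Proof. by rewrite mxE unlock. Qed.

Context (r : nat) (Y : T -> 'cV[R]_r).
Hypothesis Y2 : forall i, (fun w => Y w i ord0) \in Lfun P 2%:E.

Lemma integrable_coord_mul i k :
  P.-integrable setT (EFin \o (fun w => Y w i ord0 * Y w k ord0)).
Proof. exact/Lfun1_integrable/(Lfun2_mul_Lfun1 (Y2 i) (Y2 k)). Qed.

Lemma gram_mxE i k : expectation_mx P (fun w => Y w *m (Y w)^T) i k =
  (\int[P]_w (Y w i ord0 * Y w k ord0))%R.
Proof.
rewrite expectation_mxE; apply: eq_Rintegral => w _.
by rewrite mxE big_ord1 mxE.
Qed.

Lemma expectation_mx_lin n (V : 'M[R]_(r, n)) :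
  expectation_mx P (fun w => Y w *m (- (V^T *m Y w))^T) =
  - (expectation_mx P (fun w => Y w *m (Y w)^T) *m V).
Proof.
apply/matrixP => i j; rewrite expectation_mxE mxE mxE -sumrN.
under [RHS]eq_bigr do rewrite gram_mxE mulrC -mulNr.
rewrite -(Rintegral_lincomb (fun k => - V k j)); last exact: integrable_coord_mul.
apply: eq_Rintegral => w _.
rewrite mxE big_ord1 !mxE mulrN mulr_sumr -sumrN; apply: eq_bigr => k _.
by rewrite !mxE; ring.
Qed.

(** For a row [v] in the kernel and [s = v Y], each [E[s Y_k]] is a coordinate of [v C_Y = 0], so
    [E[s^2] = 0]; then [s] vanishes almost surely and independence gives [v = 0]. *)
Lemma gram_mx_unit : L2_lin_indep P Y ->
  expectation_mx P (fun w => Y w *m (Y w)^T) \in unitmx.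
Proof.
move=> Yi; rewrite -row_free_unit -kermx_eq0.
apply/eqP/row_matrixP => i; rewrite row0.
set v := row i _.
have vC : v *m expectation_mx P (fun w => Y w *m (Y w)^T) = 0.
  by rewrite /v -row_mul mulmx_ker row0.
pose s w := (v *m Y w) ord0 ord0.
have sE w : s w = \sum_k v ord0 k * Y w k ord0 by rewrite /s mxE.
have s2E w : s w ^+ 2 = \sum_k v ord0 k * (s w * Y w k ord0).
  rewrite expr2 {2}sE mulr_sumr; apply: eq_bigr => k _; ring.
have isY k : P.-integrable setT (EFin \o (fun w => s w * Y w k ord0)).
  have : P.-integrable setT
      (fun w => \sum_l (v ord0 l)%:E * (Y w l ord0 * Y w k ord0)%:E)%E.
    apply: integrable_sum => // l _.
    by apply: integrableZl => //; exact: integrable_coord_mul.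
  apply: eq_integrable => // w _ /=; rewrite sE mulr_suml -sumEFin.
  by apply: eq_bigr => l _; rewrite -EFinM mulrA.
have sY0 k : (\int[P]_w (s w * Y w k ord0))%R = 0.
  transitivity ((v *m expectation_mx P (fun w => Y w *m (Y w)^T)) ord0 k); last first.
    by rewrite vC mxE.
  rewrite mxE; under [RHS]eq_bigr do rewrite gram_mxE.
  rewrite -(Rintegral_lincomb (fun k => v ord0 k)); last first.
    by move=> l; exact: integrable_coord_mul.
  apply: eq_Rintegral => w _; rewrite sE mulr_suml; apply: eq_bigr => l _.
  by rewrite mulrA.
have ss0 : (\int[P]_w (s w ^+ 2))%R = 0.
  rewrite (_ : (\int[P]_w (s w ^+ 2))%R =
    (\int[P]_w (\sum_k v ord0 k * (s w * Y w k ord0)))%R); last first.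
    by apply: eq_Rintegral => w _; rewrite s2E.
  rewrite Rintegral_lincomb// big1// => k _.
  by rewrite sY0 mulr0.
have iss : P.-integrable setT (fun w => (s w ^+ 2)%:E).
  have : P.-integrable setT
      (fun w => \sum_l (v ord0 l)%:E * (s w * Y w l ord0)%:E)%E.
    apply: integrable_sum => // l _.
    by apply: integrableZl => //; exact: isY.
  apply: eq_integrable => // w _ /=; rewrite s2E -sumEFin.
  by apply: eq_bigr => l _; rewrite -EFinM.
have ms : measurable_fun setT s.
  rewrite (_ : s = fun w => \sum_k v ord0 k * Y w k ord0); last exact/funext.
  apply: measurable_sum => k; apply: measurable_funM => //.
  by have := Y2 k; rewrite inE => /andP[/[!inE]].
have s0 : {ae P, forall w, s w = 0}.
  apply: second_moment_le0_ae => //.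
  rewrite -(fineK (integrable_fin_num _ iss))//.
  by move: ss0; rewrite /Rintegral => ->.
apply: Yi; apply: filterS s0 => w sw0.
by apply/matrixP => a b; rewrite !ord1 [RHS]mxE.
Qed.

End second_moment_matrix.

Section DO_constant.
Context d (T : measurableType d) (R : realType) (P : probability T R)
  (F : R -> set (set T)) (r n m : nat) (W : R -> T -> 'cV[R]_m)
  (sigma : R -> 'cV[R]_n -> 'M[R]_(n, m)) (U : R -> 'M[R]_(r, n))
  (Y : R -> T -> 'cV[R]_r).
Hypothesis hUY : is_strong_DO_solution P F W (fun _ x => - x) sigma U Y.

(* The drift -x maps the row space of U into itself, so it is annihilated by
   I - U^T U, and invertibility of the Gram matrix of Y gives U' = 0. *)
Lemma DO_linear_drift_constant t : 0 <= t -> U t = U 0.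
Proof.
move=> t0; apply/matrixP => i j.
apply: (@absolutely_continuous_derive0 R (fun s => U s i j) 0 t t0).
  exact: do_ac hUY _ t0 i j.
have FF := ae_filter_ringOfSetsType (@lebesgue_measure R).
apply: (@filterS3 _ _ FF _ _ _ _ _ (do_eq_U hUY) (do_orthonormal hUY)
  (do_derivable hUY)).
move=> s eqU ort der /andP[s0 _].
have {}der := der s0; have [{}ort _] := ort s0; have {}eqU := eqU s0.
have Y2 := do_L2 hUY s0.
have U'0 : derive1 U s = 0.
  have Cu := gram_mx_unit Y2 (do_indep hUY s0).
  (* Here the right-hand side is [- C_Y U (I - U^T U)], and [U U^T = I] cancels it. *)
  have H : expectation_mx P (fun w => Y s w *m (Y s w)^T) *m derive1 U s = 0.
    rewrite eqU (expectation_mx_lin Y2) mulNmx mulmxBr mulmx1 -mulmxA.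
    by rewrite (mulmxA (U s)) ort mul1mx subrr oppr0.
  by rewrite -[LHS](mulKmx Cu) H mulmx0.
apply: DeriveDef; first exact: ((derivable_mxP _ _ _).1 der).
have := derive_mx der; rewrite -derive1E U'0 => /matrixP /(_ i j).
by rewrite !mxE.
Qed.

End DO_constant.

(** * Linear equations with additive noise *)

Section linear_sde.
Context d (T : measurableType d) (R : realType) (P : probability T R)
  (F : R -> set (set T)) (k m : nat) (W : R -> T -> 'cV[R]_m).
Hypotheses (hF : is_filtration F) (hW : is_brownian P F W).
Context (beta : R -> T -> 'cV[R]_k) (phi : R -> T -> 'M[R]_(k, m))
  (Z : R -> T -> 'cV[R]_k) (M : 'M[R]_(k, m)).
Hypotheses (hZ : is_ito_process P F W beta phi Z)
  (betaE : forall s w, 0 <= s -> beta s w = - Z s w)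
  (phiE : forall s w, 0 <= s -> phi s w = M).

(** With the Ito integral identified as [M (W_s - W_0)], the equation becomes a pathwise integral
    equation driven by [M W]. *)
Lemma linear_sde_eq s : 0 <= s -> {ae P, forall w, forall i,
  Z s w i ord0 = Z 0 w i ord0 +
    (\int[lebesgue_measure]_(u in `[0, s]) (- Z u w i ord0))%R +
    ((M *m W s w) i ord0 - (M *m W 0 w) i ord0)}.
Proof.
move=> s0; have [I [J [hJ IE]] eqZ] := ip_eq hZ s0.
have hJ' : {ae P, forall w, forall i j,
    J i j w = M i j * (W s w j ord0 - W 0 w j ord0)}.
  apply: filter_forall => i; apply: filter_forall => j.
  apply: (ito_integral1_constant hF hW s0 _ (hJ i j)) => u w /andP[u0 _].
  by rewrite phiE.
apply: filterS2 eqZ hJ' => w -> JE i; rewrite IE !mxE; congr (_ + _ + _).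
  apply: eq_Rintegral => u; rewrite inE/= in_itv/= => /andP[u0 _].
  by rewrite betaE// mxE.
by rewrite -sumrB; apply: eq_bigr => j _; rewrite JE mulrBr.
Qed.

Lemma linear_sde_scheme_cvg t : 0 <= t -> {ae P, forall w, forall i,
  exp_scheme t n (Z 0 w i ord0) (fun s => (M *m W s w) i ord0) @[n --> \oo] -->
  Z t w i ord0}.
Proof.
move=> t0.
(* One null set must serve for all grid points at once, and these are countably many. *)
have eqZ : {ae P, forall w, forall n l i, Z (grid t n l) w i ord0 =
    Z 0 w i ord0 +
    (\int[lebesgue_measure]_(u in `[0, grid t n l]) (- Z u w i ord0))%R +
    ((M *m W (grid t n l) w) i ord0 - (M *m W 0 w) i ord0)}.
  apply: ae_foralln => n; apply: ae_foralln => l.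
  by apply: linear_sde_eq; exact: grid_ge0.
apply: filterS2 (ip_continuous hZ) eqZ => w cZ eqZ i.
apply: (@exp_scheme_cvg R t (fun s => Z s w i ord0)) => //.
move=> s; apply: (cvg_comp _ (fun x : 'cV[R]_k => x i ord0) (cZ s)).
exact: coord_continuous.
Qed.

(** The matrix [B] brings two equations of different dimensions to the same noise coefficient [B M]:
    [B = U_0^T], [M = U_0] for [Y], and [B = A], [M = I] for [X]. *)
Lemma linear_sde_wiener_sum_cvg p (B : 'M[R]_(p, k)) t : 0 <= t ->
  {ae P, forall w, coord_cvg (fun n => wiener_sum W (grid t n)
    (fun w => expR (- t) *: (B *m Z 0 w))
    (fun l => exp_weight t n l *: (B *m M)) n w) (B *m Z t w)}.
Proof.
move=> t0; apply: filterS (linear_sde_scheme_cvg t0) => w cZ i.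
rewrite mxE.
rewrite (_ : (fun n => _) = (fun n => \sum_j B i j *
    exp_scheme t n (Z 0 w j ord0) (fun s => (M *m W s w) j ord0))).
  apply: cvg_big => [|j _]; first exact: add_continuous.
  by apply: cvgMr; exact: cZ.
apply/funext => n; rewrite /wiener_sum /exp_scheme.
under [RHS]eq_bigr do rewrite mulrDr.
rewrite big_split/= mxE; congr (_ + _).
  by rewrite !mxE mulr_sumr; apply: eq_bigr => j _; ring.
under [RHS]eq_bigr do rewrite mulr_sumr.
rewrite exchange_big/= summxE; apply: eq_bigr => l _.
rewrite -scalemxAl mxE -mulmxA mxE mulr_sumr; apply: eq_bigr => j _.
by rewrite /increment mulmxBr !mxE /exp_weight; ring.
Qed.

End linear_sde.

Lemma same_law_comp d d1 d2 (T : measurableType d) (E1 : measurableType d1)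
    (E2 : measurableType d2) (R : realType) (P : probability T R)
    (X Y : T -> E1) (f : E1 -> E2) :
  measurable_fun setT f -> same_law P X Y ->
  same_law P (fun w => f (X w)) (fun w => f (Y w)).
Proof.
move=> mf XY B mB; apply: (XY (f @^-1` B)).
by rewrite -[X in measurable X]setTI; exact: mf.
Qed.

(** * The DLR approximation of the Ornstein-Uhlenbeck process *)

Section DLR_ornstein_uhlenbeck.
Context (R : realType) (disp : measure_display)
    (T : measurableType disp) (P : probability T R) (F : R -> set (set T))
    (r d : nat) (W X : R -> T -> 'cV[R]_d)
    (U : R -> 'M[R]_(r, d)) (Y : R -> T -> 'cV[R]_r).
Hypotheses (hr : (1 <= r <= d)%N) (hF : is_filtration F)
    (hW : is_brownian P F W)
    (hX : is_strong_solution P F W (fun _ x => - x) (fun _ _ => 1%:M) X)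
    (hUY : is_strong_DO_solution P F W (fun _ x => - x) (fun _ _ => 1%:M) U Y)
    (hX0 : is_gaussian (pushforward P (X 0)) 0 1%:M)
    (hXr0 : is_gaussian (pushforward P (DLR U Y 0)) 0 (pid_mx r)).
Local Notation A := (pid_mx r : 'M[R]_d).

(** The [j]-th coordinate of [U_0^T Y_0] vanishes almost surely under the law [N(0, A)], and it is
    the combination of the components of [Y_0] with coefficients the [j]-th column of [U_0]. *)
Lemma DO_rows_eq0 (i : 'I_r) (j : 'I_d) : (r <= j)%N -> U 0 i j = 0.
Proof.
move=> rj.
have AA : A *m A = A.
  by rewrite mul_pid_mx !minnn; have /andP[_ /minn_idPr ->] := hr.
have [||||gamma g XrE] := @is_gaussian_idempotent R d _ T P (DLR U Y 0) 1 A.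
- exact: ler01.
- exact: AA.
- by rewrite tr_pid_mx.
- by rewrite expr1n scale1r.
have mN : measurable [set x : 'cV[R]_d | x j ord0 != 0].
  rewrite (_ : [set x | _] = setT `&` (fun x : 'cV[R]_d => x j ord0) @^-1` (~` [set 0])).
    by apply: measurable_colvec_coord => //; apply: measurableC.
  by rewrite setTI; apply/seteqP; split=> x /= /eqP.
have mDLR : measurable_fun setT (DLR U Y 0).
  apply: measurable_colvec_mulmx.
  have mY0 := ip_adapted (do_eq_Y hUY) (lexx (0 : R)).
  exact: measurable_wrt_measurable (filtration_sub hF (lexx 0)) mY0.
have row0 : row j (U 0)^T = 0.
  apply: (do_Y0 hUY); exists (DLR U Y 0 @^-1` [set x | x j ord0 != 0]); split.
  - by rewrite -[X in measurable X]setTI; exact: mDLR.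
  - rewrite XrE// (_ : _ @^-1` _ = set0) ?measure0//; apply/seteqP; split=> z //=.
    by rewrite scale1r mul_pid_mx_coord ltnNge rj/= eqxx.
  - move=> w /= h; apply/negP => /eqP z0; apply: h.
    apply/matrixP => a b; rewrite !ord1 -row_mul !mxE.
    by move: z0; rewrite /DLR mxE.
by move/matrixP: row0 => /(_ ord0 i); rewrite !mxE.
Qed.

Lemma DO_proj_init : (U 0)^T *m U 0 = A.
Proof.
apply: orthonormal_rows_proj; first by case/andP: hr.
- exact: do_U0 hUY.
- exact: DO_rows_eq0.
Qed.

Lemma DLRE t w : 0 <= t -> DLR U Y t w = (U 0)^T *m Y t w.
Proof. by move=> t0; rewrite /DLR (DO_linear_drift_constant hUY t0). Qed.

Let itoX : is_ito_process P F W (fun t w => - X t w) (fun _ _ => 1%:M) X := hX.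

Let mX t : 0 <= t -> measurable_fun setT (X t).
Proof.
move=> t0; have mXt := ip_adapted itoX t0.
exact: measurable_wrt_measurable (filtration_sub hF t0) mXt.
Qed.

Let mY t : 0 <= t -> measurable_fun setT (Y t).
Proof.
move=> t0; have mYt := ip_adapted (do_eq_Y hUY) t0.
exact: measurable_wrt_measurable (filtration_sub hF t0) mYt.
Qed.

Let mDLR t : 0 <= t -> measurable_fun setT (DLR U Y t).
Proof. by move=> t0; apply: measurable_colvec_mulmx; exact: mY. Qed.

Lemma OU_second_moment t (i : 'I_d) : 0 <= t ->
  (\int[P]_w ((X t w i ord0) ^+ 2)%:E =
   (expR (- (2 * t)) + (1 - expR (- (2 * t))) / 2)%:E)%E.
Proof.
move=> t0.
have sF := filtration_sigma hF (lexx 0).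
have mX0 : measurable_wrt (F 0) (fun w => X 0 w i ord0).
  apply/(measurable_wrtP sF).
  have /(measurable_wrtP sF) mx := ip_adapted itoX (lexx (0 : R)).
  exact: (measurableT_comp (measurable_colvec_coord i) mx).
have v1 : (\int[P]_w ((X 0 w i ord0) ^+ 2)%:E = 1%:E)%E.
  have := is_gaussian_scalar_affine_sqr i 0 1 ler01 (mX (lexx 0)) hX0.
  rewrite expr0n/= expr1n mulr1 add0r => <-.
  by apply: eq_integral => w _; rewrite add0r mul1r.
have mXi := measurableT_comp (measurable_colvec_coord i) (mX t0).
rewrite (limit_second_moment hF hW t0 (i := i) mX0 mXi v1) ?mulr1//.
have := linear_sde_scheme_cvg hF hW (M := 1%:M) itoX _ _ t0.
move=> /(_ (fun _ _ _ => erefl) (fun _ _ _ => erefl)).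
apply: filterS => w /(_ i); rewrite /comp/=.
rewrite (_ : (fun s => (1%:M *m W s w) i ord0) = fun s => W s w i ord0)//.
by apply/funext => s; rewrite mul1mx.
Qed.

Lemma DLR_same_law t : 0 <= t -> same_law P (DLR U Y t) (fun w => A *m X t w).
Proof.
move=> t0.
have U0U0 : U 0 *m (U 0)^T = 1%:M by exact: do_U0 hUY.
have Uc := DO_linear_drift_constant hUY.
pose c n l := exp_weight t n l *: A.
pose V1 w := expR (- t) *: ((U 0)^T *m Y 0 w).
pose V2 w := expR (- t) *: (A *m X 0 w).
have F0 : measurable_wrt (F 0) V1 /\ measurable_wrt (F 0) V2.
  have sF := filtration_sigma hF (lexx 0).
  have /(measurable_wrtP sF) mx := ip_adapted itoX (lexx (0 : R)).
  have /(measurable_wrtP sF) my := ip_adapted (do_eq_Y hUY) (lexx (0 : R)).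
  by split; apply/(measurable_wrtP sF); apply: measurable_colvecZ;
    exact: measurable_colvec_mulmx.
have gS n l : (l < n)%N -> grid t n l <= grid t n l.+1 by move=> _; exact: grid_le.
have g0 n : 0 <= grid t n 0 by rewrite grid0.
have mws n V : measurable_wrt (F 0) V ->
    measurable_fun setT (wiener_sum W (grid t n) V (c n) n).
  move=> mV; have gn := grid_ge0 n n t0.
  apply: measurable_wrt_measurable (filtration_sub hF gn) _.
  apply: (measurable_wiener_sum hF hW (g0 n) (gS n)) => //.
  by rewrite grid0.
have mAX : measurable_fun setT (fun w => A *m X t w).
  by apply: measurable_colvec_mulmx; exact: mX.
apply: (same_law_limit (X_ := fun n => wiener_sum W (grid t n) V1 (c n) n)
  (Y_ := fun n => wiener_sum W (grid t n) V2 (c n) n)).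
- by move=> n; apply: mws; case: F0.
- by move=> n; apply: mws; case: F0.
- exact: mDLR.
- exact: mAX.
- have := linear_sde_wiener_sum_cvg hF hW (M := U 0) (do_eq_Y hUY) _ _ (U 0)^T t0.
  have h1 (s : R) (w : T) : 0 <= s -> U s *m - ((U s)^T *m Y s w) = - Y s w.
    by move=> s0; rewrite (Uc _ s0) mulmxN mulmxA U0U0 mul1mx.
  have h2 (s : R) (w : T) : 0 <= s -> U s *m 1%:M = U 0.
    by move=> s0; rewrite (Uc _ s0) mulmx1.
  move=> /(_ h1 h2); apply: filterS => w.
  by rewrite (DLRE _ t0) DO_proj_init.
- have := linear_sde_wiener_sum_cvg hF hW (M := 1%:M) itoX _ _ A t0.
  move=> /(_ (fun _ _ _ => erefl) (fun _ _ _ => erefl)).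
  by apply: filterS => w; rewrite mulmx1.
- move=> n.
  apply: (same_law_wiener_sum hF hW (g0 n) (gS n)).
  + by rewrite grid0; case: F0.
  + by rewrite grid0; case: F0.
  + apply: (same_law_comp (f := fun x : 'cV[R]_d => expR (- t) *: x)).
      by apply: measurable_colvecZ; exact: measurable_id.
    have AA : A *m A = A.
      by rewrite mul_pid_mx !minnn; have /andP[_ /minn_idPr ->] := hr.
    exact: (is_gaussian_proj_same_law (mX (lexx 0)) AA (tr_pid_mx _ _ _ _) hX0 hXr0).
Qed.

Lemma wasserstein2_DLR_OU t : 0 <= t ->
  (wasserstein2 (pushforward P (DLR U Y t)) (pushforward P (X t)) ^+ 2 =
   ((expR (- (2 * t)) + (1 - expR (- (2 * t))) / 2) * (d - r)%:R)%:E)%E.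
Proof.
move=> t0; rewrite (wasserstein2_pid_mx (mX t0) (mDLR t0) (DLR_same_law t0)).
under eq_bigr do rewrite OU_second_moment//.
set c := _ + _; rewrite sumEFin; congr EFin.
by rewrite -(big_geq_mkord _ _ xpredT (fun=> c)) sumr_const_nat mulr_natr.
Qed.

End DLR_ornstein_uhlenbeck.

Theorem mainTheorem4 (R : realType) (disp : measure_display)
    (T : measurableType disp) (P : probability T R) (F : R -> set (set T))
    (r d : nat) (W X : R -> T -> 'cV[R]_d)
    (U : R -> 'M[R]_(r, d)) (Y : R -> T -> 'cV[R]_r)
    (hr : (1 <= r <= d)%N)
    (hP : measure_is_complete P)
    (hF : is_filtration F)
    (hW : is_brownian P F W)
    (hX : is_strong_solution P F W (fun _ x => - x) (fun _ _ => 1%:M) X)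
    (hUY : is_strong_DO_solution P F W (fun _ x => - x) (fun _ _ => 1%:M) U Y)
    (hX0 : is_gaussian (pushforward P (X 0)) 0 1%:M)
    (hXr0 : is_gaussian (pushforward P (DLR U Y 0)) 0 (pid_mx r))
    (t : R) (ht : 0 <= t) :
  (wasserstein2 (pushforward P (DLR U Y t)) (pushforward P (X t)) ^+ 2 =
   (expR (- (2 * t)))%:E *
     wasserstein2 (pushforward P (X 0%R)) (pushforward P (DLR U Y 0%R)) ^+ 2 +
   ((1 - expR (- (2 * t))) / 2 * (d - r)%:R)%:E)%E.
Proof.
(* The two initial laws occur in the opposite order. The closed formula is then used at [t] and at
   0, where it equals [d - r]. *)
rewrite (wasserstein2C (pushforward P (X 0%R))).
rewrite (wasserstein2_DLR_OU hr hF hW hX hUY hX0 hXr0 ht).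
rewrite (wasserstein2_DLR_OU hr hF hW hX hUY hX0 hXr0 (lexx 0)).
by rewrite mulr0 oppr0 expR0 subrr mul0r addr0 mul1r -EFinM -EFinD -mulrDl.
Qed.
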